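(* Consider the cutting-plane algorithm which, in every round $t$, queries the point $p_t=\mathsf{cg}\big(K_t+\tfrac1T\mathsf{B}\big)$, where $K_t$ is the current knowledge set. For every horizon $T\ge 1$, every hidden point $w^*\in\mathsf{B}$ and every (strong) separation oracle, this algorithm incurs regret $O(d\log T)$.
   Context: $\mathsf{B}=\{w\in\mathbb{R}^d:\|w\|_2\le 1\}$, $+$ denotes Minkowski sum, and $\mathsf{cg}(L)=\big(\int_L x\,dx\big)/\big(\int_L 1\,dx\big)$ is the center of gravity. Cutting-plane problem: there is a hidden $w^*\in\mathsf{B}$. In each round $t=1,\dots,T$ the learner queries a point $p_t$, and a (strong) separation oracle returns a unit vector $v_t$, chosen adversarially and possibly depending on $p_t$ and on the history, such that $\langle w^*,v_t\rangle\ge\langle p_t,v_t\rangle$. The regret is $\sum_{t=1}^T\langle w^*-p_t,v_t\rangle$. The knowledge set is $K_1=\mathsf{B}$ and $K_{t+1}=K_t\cap\{w:\langle w-p_t,v_t\rangle\ge0\}$. *)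

(* Defs.v *)
From HB Require Import structures.
From mathcomp Require Import all_boot all_order all_algebra.
From mathcomp Require Import all_classical all_reals all_analysis.
Set Implicit Arguments. Unset Strict Implicit. Unset Printing Implicit Defensive.
Import Order.TTheory GRing.Theory Num.Theory.
Local Open Scope classical_set_scope.
Local Open Scope ring_scope.

Section CuttingPlane.
Variable R : realType.
Variable d : nat.
Notation vec := 'rV[R]_d.

Definition dotp (u v : vec) : R := \sum_(i < d) u 0 i * v 0 i.
Definition norm2 (w : vec) : R := Num.sqrt (\sum_(i < d) (w 0 i) ^+ 2).

Definition ballB (r : R) : set vec := [set w | norm2 w <= r].

Definition minkowski (A B : set vec) : set vec :=
  [set z | exists x y, A x /\ B y /\ z = x + y].

(* Integral over R^d with respect to d-dimensional Lebesgue measure,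
   written as the iterated one-dimensional Lebesgue integral (Fubini):
   coordinates d-1, ..., 0 are integrated successively. *)
Fixpoint iint (n : nat) (f : (nat -> R) -> R) : R :=
  match n with
  | 0%N => f (fun _ => 0)
  | m.+1 => Rintegral (@lebesgue_measure R) setT
              (fun x => iint m (fun g => f (fun i => if i == m then x else g i)))
  end.

Definition integral_Rd (F : vec -> R) : R :=
  iint d (fun g => F (\row_(i < d) g (nat_of_ord i))).

Definition indic (L : set vec) (x : vec) : R := if `[< L x >] then 1 else 0.

Definition vol (L : set vec) : R := integral_Rd (indic L).
Definition cg (L : set vec) : vec :=
  \row_(i < d) (integral_Rd (fun x => indic L x * x 0 i) / vol L).

Definition halfspace (p v : vec) : set vec := [set w | dotp (w - p) v >= 0].

Definition knowledge (h : seq (vec * vec)) : set vec :=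
  [set w | ballB 1 w /\ forall pv, pv \in h -> halfspace pv.1 pv.2 w].

Definition query (T : nat) (h : seq (vec * vec)) : vec :=
  cg (minkowski (knowledge h) (ballB (T%:R)^-1)).

Definition oracle_t := seq (vec * vec) -> vec -> vec.

Fixpoint history (T : nat) (O : oracle_t) (t : nat) : seq (vec * vec) :=
  match t with
  | 0%N => [::]
  | t'.+1 => let h := history T O t' in
             let p := query T h in rcons h (p, O h p)
  end.

Definition valid_oracle (T : nat) (wstar : vec) (O : oracle_t) : Prop :=
  forall pv, pv \in history T O T ->
    norm2 pv.2 = 1 /\ dotp wstar pv.2 >= dotp pv.1 pv.2.

Definition regret (T : nat) (wstar : vec) (O : oracle_t) : R :=
  \sum_(pv <- history T O T) dotp (wstar - pv.1) pv.2.

End CuttingPlane.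

(* Main.v *)
(** Let K be K_t + B/T, V its volume, p its centroid, Y x = <x - p, v_t> and w = Y w* the regret
    of the round. The integrals of the positive and negative parts of Y over K have a common
    value N. A homothety of ratio d/(d+1) centred at w* maps K into itself, which gives
    w V <= 2 e d N. On the other hand y |-> vol (K and {Y < y}) is log-concave
    (Prekopa-Leindler), so that if at most one eighth of K lies in {Y < -1/T}, then N <= 7V/(4T).
    Hence either w = O(d/T), or K_(t+1) + B/T, which is contained in K and {Y >= -1/T}, has volume
    at most 7V/8. In the second case w <= 3 is charged to the decrease of ln V; the total decrease
    is at most d ln (T+1), as w* + B/T is always contained in K_t + B/T, which is contained in
    (1 + 1/T) B. *)
From Pilot Require Import Defs.
From HB Require Import structures.
From mathcomp Require Import all_boot all_order all_algebra.
From mathcomp Require Import all_classical all_reals all_analysis.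
From mathcomp Require Import measurable_realfun ring lra.
(* Again, since [numfun.indic] shadows [Defs.indic]. *)
Import Pilot.Defs.
Import Order.TTheory GRing.Theory Num.Theory.
Import numFieldNormedType.Exports.
Local Open Scope ring_scope.
Local Open Scope classical_set_scope.

(** * Prekopa-Leindler on the line *)

(** Adding or comparing values of [integral_Rd], an iterated integral, requires every inner integral
    to be an integrable function of the next variable. This is derived from log-concavity: each
    integrand is written as a linear combination of indicators of convex sets and of nonnegative
    concave functions cut off to convex sets. Prekopa-Leindler thus serves twice, for integrability
    and for the decay of the tails of [Y]. The body keeps a margin 1/T behind the hyperplane through
    its centroid, so a round need not remove a constant fraction of the volume: this fails when the
    body is thin in the direction v_t, and then w must be small. In quantifying this, the length
    over which the tails decay involves N / V itself, so N stands on both sides of the estimate; the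
    threshold one eighth gives it the coefficient 1/3 on the right, where it can be absorbed. *)

Section GeometricMean.
Variable R : realType.
Implicit Types (t a b c m : R).

(* Only meaningful for [0 < t < 1]: since [0 `^ 0 = 1], it does not vanish with [a] at [t = 0]. *)
Definition gmean t a b := a `^ t * b `^ (1 - t).

Lemma gmean_ge0 t a b : 0 <= gmean t a b.
Proof. by rewrite mulr_ge0 ?powR_ge0. Qed.

Lemma gmean_le t a a' b b' : 0 < t < 1 -> 0 <= a -> a <= a' -> 0 <= b -> b <= b' ->
  gmean t a b <= gmean t a' b'.
Proof.
move=> /andP[t0 t1] a0 aa' b0 bb'.
have a0' := le_trans a0 aa'; have b0' := le_trans b0 bb'.
by apply: ler_pM; rewrite ?powR_ge0 ?ge0_ler_powR ?nnegrE ?subr_ge0 // ltW.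
Qed.

Lemma gmean_lt t a a' b b' : 0 < t < 1 -> 0 <= a -> a < a' -> 0 <= b -> b < b' ->
  gmean t a b < gmean t a' b'.
Proof.
move=> /andP[t0 t1] a0 aa' b0 bb'.
have a0' := le_trans a0 (ltW aa'); have b0' := le_trans b0 (ltW bb').
by apply: ltr_pM; rewrite ?powR_ge0 ?gt0_ltr_powR ?nnegrE ?subr_gt0.
Qed.

Lemma gmeanM t a a' b b' : 0 <= a -> 0 <= a' -> 0 <= b -> 0 <= b' ->
  gmean t (a * a') (b * b') = gmean t a b * gmean t a' b'.
Proof. by move=> *; rewrite /gmean !powRM// mulrACA. Qed.

Lemma gmeanxx t m : 0 < t < 1 -> 0 <= m -> gmean t m m = m.
Proof.
move=> /andP[t0 t1] m0; rewrite /gmean -powRD; first by rewrite addrC subrK powRr1.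
by rewrite addrC subrK oner_eq0.
Qed.

Lemma gmean0l t b : 0 < t < 1 -> gmean t 0 b = 0.
Proof. by move=> /andP[t0 t1]; rewrite /gmean powR0 ?mul0r ?gt_eqF. Qed.

Lemma gmean0r t a : 0 < t < 1 -> gmean t a 0 = 0.
Proof. by move=> /andP[t0 t1]; rewrite /gmean powR0 ?mulr0 ?gt_eqF ?subr_gt0. Qed.

Lemma gmean_gt0 t a b : 0 < a -> 0 < b -> 0 < gmean t a b.
Proof. by move=> a0 b0; rewrite mulr_gt0 ?powR_gt0. Qed.

(** Young's inequality with exponents 1/t and 1/(1 - t), applied to the two factors of [gmean]. *)
Lemma gmean_le_amean t a b : 0 < t < 1 -> 0 <= a -> 0 <= b ->
  gmean t a b <= t * a + (1 - t) * b.
Proof.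
move=> /andP[t0 t1] a0 b0.
have t1' : 0 < 1 - t by rewrite subr_gt0.
have := @conjugate_powR R (a `^ t) (b `^ (1 - t)) t^-1 (1 - t)^-1.
rewrite !powR_ge0 !invr_gt0 t0 t1' !invrK -!powRrM !divff ?gt_eqF// !powRr1//.
by rewrite [a * t]mulrC [b * _]mulrC; apply => //; rewrite addrC subrK.
Qed.

Lemma minr_le_gmean t a b : 0 < t < 1 -> 0 <= a -> 0 <= b ->
  Num.min a b <= gmean t a b.
Proof.
move=> t01 a0 b0; have m0 : 0 <= Num.min a b by rewrite le_min a0.
rewrite -[leLHS](gmeanxx t)//; apply: gmean_le => //.
  by rewrite ge_min lexx.
by rewrite ge_min lexx orbT.
Qed.

End GeometricMean.
Arguments gmean {R} t a b.

(** * Affine substitution and integrability on the line *)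

Section RealLine.
Variable R : realType.
Local Notation mu := (@lebesgue_measure R).
Implicit Types (F G H : R -> R).

(** The scaled pushforward agrees with [mu] on half-open intervals, which determine the measure. *)
Lemma lebesgue_measure_affine (a b : R) (A : set (measurableTypeR R)) : 0 < a ->
  measurable A ->
  mu A = (a%:E * mu ((fun x : R => (a * x + b)%R) @^-1` A))%E.
Proof.
move=> a0 mA; set phi := fun x : measurableTypeR R => (a * x + b)%R : measurableTypeR R.
have mphi : measurable_fun setT phi.
  by apply: measurable_funD => //; exact: measurable_funM.
pose k : {nonneg R} := NngNum (ltW a0).
apply: (@lebesgue_measure_unique _ (mscale k (pushforward mu phi))) => //= _ [[u v]] _ <-.
rewrite /mscale/= /pushforward.
have -> : phi @^-1` `]u, v] = `](u - b) / a, (v - b) / a].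
  apply/seteqP; split => x /=; rewrite !in_itv/= /phi;
  by rewrite ltr_pdivrMr// ler_pdivlMr// ltrBlDr lerBrDr [x * a]mulrC.
rewrite !lebesgue_measure_itv/= !lte_fin ltr_pM2r ?invr_gt0// ltrD2r.
case: ifPn => uv; rewrite ?mule0// -!EFinB -EFinM; congr (_%:E).
by field; rewrite gt_eqF.
Qed.

Lemma ge0_integral_affine F (a b : R) : 0 < a -> measurable_fun setT F ->
  (forall x, 0 <= F x) ->
  (\int[mu]_x (F x)%:E = a%:E * \int[mu]_x (F (a * x + b))%:E)%E.
Proof.
move=> a0 mF F0.
set phi := fun x : measurableTypeR R => (a * x + b)%R : measurableTypeR R.
have mphi : measurable_fun setT phi.
  by apply: measurable_funD => //; exact: measurable_funM.
pose k : {nonneg R} := NngNum (ltW a0).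
have mEF : measurable_fun setT (EFin \o F) by exact/measurable_EFinP.
rewrite (eq_measure_integral (mscale k (pushforward mu phi))); last first.
  by move=> A mA _; exact: lebesgue_measure_affine.
rewrite ge0_integral_mscale//; last by move=> x _; rewrite lee_fin.
rewrite (@ge0_integral_pushforward _ _ _ _ _ phi)//.
by move=> x _; rewrite lee_fin.
Qed.

Lemma integrable_affine F (a b : R) : 0 < a -> mu.-integrable setT (EFin \o F) ->
  (forall x, 0 <= F x) ->
  mu.-integrable setT (EFin \o (fun x => F (a * x + b))) /\
  Rintegral mu setT F = a * Rintegral mu setT (fun x => F (a * x + b)).
Proof.
move=> a0 iF F0; have [mF finF] := integrableP _ _ _ iF.
have mF' : measurable_fun setT F by exact/measurable_EFinP.
have E := ge0_integral_affine F a b a0 mF' F0.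
have iG : mu.-integrable setT (EFin \o (fun x => F (a * x + b))).
  apply/integrableP; split.
    apply/measurable_EFinP/(measurableT_comp mF').
    by apply: measurable_funD => //; exact: measurable_funM.
  move: finF; under eq_integral do rewrite /= ger0_norm//.
  under [X in _ -> (X < _)%E]eq_integral do rewrite /= ger0_norm//.
  rewrite E; have : (0 <= \int[mu]_x (F (a * x + b))%:E)%E.
    by apply: integral_ge0 => x _; rewrite lee_fin.
  suff : (0 <= \int[mu]_x (F (a * x + b))%:E)%E ->
    (a%:E * \int[mu]_x (F (a * x + b))%:E < +oo)%E ->
    (\int[mu]_x (F (a * x + b))%:E < +oo)%E by [].
  case: (\int[mu]_x (F (a * x + b))%:E)%E => [s _ _||//]; first by rewrite ltry.
  by rewrite mulry gtr0_sg// mul1e.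
split => //; rewrite /Rintegral E fineM//.
exact: integrable_fin_num.
Qed.

(** Stated through strict superlevel sets: being intervals, they make [F] measurable and have a
    length that can be read off from their endpoints. *)
Definition quasiconcave F := forall s, is_interval [set x | s < F x].

Lemma quasiconcave_measurable F : quasiconcave F -> measurable_fun setT F.
Proof.
move=> qF mD; apply: (measurability _ (RGenOInfty.measurableE R)) => //.
move=> _ [_ [x ->] <-]; rewrite setTI; apply: is_interval_measurable.
suff -> : F @^-1` `]x, +oo[ = [set y | x < F y] by exact: qF.
by apply/seteqP; split => y /=; rewrite in_itv/= andbT.
Qed.

Definition bounded_support (M r : R) F :=
  (forall x, 0 <= F x <= M) /\ (forall x, r < `|x| -> F x = 0).

Lemma integrableM_EFin F (c : R) : mu.-integrable setT (EFin \o F) ->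
  mu.-integrable setT (EFin \o (fun x => c * F x)).
Proof.
move=> /(integrableZl measurableT c).
by congr (mu.-integrable _ _); apply/funext => x /=; rewrite EFinM.
Qed.

Lemma integrableD_EFin F G : mu.-integrable setT (EFin \o F) ->
  mu.-integrable setT (EFin \o G) ->
  mu.-integrable setT (EFin \o (fun x => F x + G x)).
Proof. exact: integrableD. Qed.

Lemma Rintegral_box (M r : R) : 0 <= r ->
  mu.-integrable setT (EFin \o (fun x => M * \1_(`[-r, r]) x)) /\
  Rintegral mu setT (fun x => M * \1_(`[-r, r]) x) = M * (2 * r).
Proof.
move=> r0; have I1 : mu.-integrable setT (EFin \o \1_(`[-r, r])).
  apply/integrableP; split; first exact/measurable_EFinP.
  under eq_integral do rewrite /= ger0_norm//.
  rewrite integral_indic// setIT /= lebesgue_measure_itv/=.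
  by case: ifP; rewrite ?ltry// -EFinB ltry.
split.
  exact: integrableM_EFin.
rewrite RintegralZl//; congr (_ * _); rewrite /Rintegral integral_indic// setIT.
rewrite /= lebesgue_measure_itv/= lte_fin; case: ltP => rr /=.
  by ring.
by lra.
Qed.

Lemma bounded_support_integrable M r F : 0 <= r -> measurable_fun setT F ->
  bounded_support M r F ->
  mu.-integrable setT (EFin \o F) /\ 0 <= Rintegral mu setT F <= M * (2 * r).
Proof.
move=> r0 mF [bF sF]; have [IM eM] := Rintegral_box M r r0.
have M0 : 0 <= M by have /andP[/le_trans h /h] := bF 0.
have leFM x : F x <= M * \1_(`[-r, r]) x.
  rewrite indicE; case: (leP `|x| r) => xr.
    rewrite mem_set/= ?mulr1; last by rewrite in_itv/= -ler_norml.
    by have /andP[] := bF x.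
  by rewrite sF// mulr_ge0.
have IF : mu.-integrable setT (EFin \o F).
  apply: (le_integrable measurableT _ _ IM) => //=; first exact/measurable_EFinP.
  move=> x _; rewrite lee_fin !ger0_norm//; first by rewrite mulr_ge0.
  by have /andP[] := bF x.
split => //; apply/andP; split; first by apply: Rintegral_ge0 => x _; have /andP[] := bF x.
by rewrite -eM; apply: le_Rintegral.
Qed.

End RealLine.
Arguments quasiconcave {R} F.
Arguments bounded_support {R} M r F.

(** * Layers and the one-dimensional inequality *)

Section PrekopaLeindlerLine.
Variable R : realType.
Local Notation mu := (@lebesgue_measure R).
Implicit Types (F G H : R -> R).

(** The sum counts the levels h, 2h, ..., nh below [y]. With [le_staircase] this is a discrete layer
    cake with error [h], used for superlevel sets here and for the tails of [Y] later. *)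
Lemma staircase_le (h y : R) n : 0 < h -> 0 <= y ->
  h * (\sum_(k < n) (h * k.+1%:R < y)%R%:R) <= y.
Proof.
move=> h0 y0; elim: n => [|n IH]; first by rewrite big_ord0 mulr0.
rewrite big_ord_recr/=; case: ltP => hy; last by rewrite addr0.
apply: le_trans (ltW hy); rewrite ler_pM2l// -natr1 lerD2r.
have -> : (n%:R : R) = \sum_(i < n) 1 by rewrite sumr_const card_ord.
by apply: ler_sum => i _; case: ltP.
Qed.

Lemma le_staircase (h y : R) n : 0 < h -> y <= h * n.+1%:R ->
  y <= h + h * (\sum_(k < n) (h * k.+1%:R < y)%R%:R).
Proof.
move=> h0; elim: n => [|n IH] yn; first by rewrite big_ord0 mulr0 addr0 (le_trans yn)// mulr1.
have [hy|hy] := leP y (h * n.+1%:R).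
  rewrite (le_trans (IH hy))// lerD2l ler_pM2l// big_ord_recr/= lerDl.
  by case: ltP.
rewrite (le_trans yn)// -natr1 mulrDr mulr1 addrC lerD2l ler_pM2l//.
have -> : (n.+1%:R : R) = \sum_(i < n.+1) 1 by rewrite sumr_const card_ord.
apply: ler_sum => i _; rewrite (le_lt_trans _ hy)// ler_pM2l// ler_nat.
exact: ltn_ord.
Qed.

Definition len (A : set R) : R := fine (mu A).

(** The interval is squeezed between the open and the closed interval with endpoints [inf I] and
    [sup I]. *)
Lemma interval_len (I : set R) : is_interval I -> I !=set0 -> has_ubound I ->
  has_lbound I -> len I = sup I - inf I.
Proof.
move=> iI [x Ix] ub lb; have supI : has_sup I by split => //; exists x.
have infI : has_inf I by split => //; exists x.
have ux := ub_le_sup ub Ix; have lx := ge_inf lb Ix.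
have mI := is_interval_measurable iI.
have le1 : (mu I <= (sup I - inf I)%:E)%E.
  apply: (@le_trans _ _ (mu `[inf I, sup I]%classic)).
    apply: le_measure; rewrite ?inE// => y Iy /=; rewrite in_itv/=.
    by rewrite (ge_inf lb Iy) (ub_le_sup ub Iy).
  by rewrite lebesgue_measure_itv/= lte_fin; case: ltP => // h; rewrite lee_fin; lra.
have le2 : ((sup I - inf I)%:E <= mu I)%E.
  have sI : `]inf I, sup I[ `<=` I.
    move=> z /=; rewrite in_itv/= => /andP[z1 z2].
    have [p Ip pz] := inf_lt infI.1 z1.
    have [q Iq qz] := sup_gt supI.1 z2.
    by apply: (iI p q) => //; rewrite (ltW pz) (ltW qz).
  apply: (@le_trans _ _ (mu `]inf I, sup I[%classic)); last first.
    by apply: le_measure; rewrite ?inE.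
  rewrite lebesgue_measure_itv/= lte_fin; case: ltP => // h; rewrite lee_fin; lra.
by rewrite /len (@le_anti _ _ (mu I) (sup I - inf I)%:E)// le1.
Qed.

(** One-dimensional Brunn-Minkowski inequality: [sup L] is at least, and [inf L] at most, the
    corresponding combination of endpoints. *)
Lemma interval_len_combination (t : R) (I J L : set R) : 0 < t < 1 ->
  is_interval I -> is_interval J -> is_interval L ->
  I !=set0 -> J !=set0 -> has_ubound I -> has_lbound I ->
  has_ubound J -> has_lbound J -> has_ubound L -> has_lbound L ->
  (forall x y, I x -> J y -> L (t * x + (1 - t) * y)) ->
  t * len I + (1 - t) * len J <= len L.
Proof.
move=> /andP[t0 t1] iI iJ iL [x0 Ix] [y0 Jy] uI lI uJ lJ uL lL IJL.
have t1' : 0 < 1 - t by rewrite subr_gt0.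
have Lz := IJL _ _ Ix Jy.
rewrite !interval_len//; [|by exists (t * x0 + (1 - t) * y0)|by exists y0|by exists x0].
have supI : has_sup I by split => //; exists x0.
have infI : has_inf I by split => //; exists x0.
have supJ : has_sup J by split => //; exists y0.
have infJ : has_inf J by split => //; exists y0.
have upper : t * sup I + (1 - t) * sup J <= sup L.
  apply/ler_addgt0Pr => e e0.
  have [x Ix' xe] := sup_adherent e0 supI.
  have [y Jy' ye] := sup_adherent e0 supJ.
  have := ub_le_sup uL (IJL _ _ Ix' Jy').
  have : t * (sup I - e) < t * x by rewrite ltr_pM2l.
  have : (1 - t) * (sup J - e) < (1 - t) * y by rewrite ltr_pM2l.
  lra.
have lower : inf L <= t * inf I + (1 - t) * inf J.
  apply/ler_addgt0Pr => e e0.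
  have [x Ix' xe] := inf_adherent e0 infI.
  have [y Jy' ye] := inf_adherent e0 infJ.
  have := ge_inf lL (IJL _ _ Ix' Jy').
  have : t * x < t * (inf I + e) by rewrite ltr_pM2l.
  have : (1 - t) * y < (1 - t) * (inf J + e) by rewrite ltr_pM2l.
  lra.
lra.
Qed.

Lemma Rintegral_indic_bounded (r : R) (A : set R) : 0 <= r -> measurable A ->
  (forall x, A x -> `|x| <= r) ->
  mu.-integrable setT (EFin \o \1_A) /\ Rintegral mu setT \1_A = len A.
Proof.
move=> r0 mA bA; split.
  apply: (bounded_support_integrable _ 1 r _ r0 _ _).1 => //.
  split => x; first by rewrite indicE; case: (x \in A); rewrite ?lexx ler01.
  move=> xr; rewrite indicE; case: (boolP (x \in A)) => // /set_mem/bA.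
  by rewrite leNgt xr.
by rewrite /Rintegral integral_indic// setIT.
Qed.

Section Layers.
Variables (M r : R) (F : R -> R).
Hypotheses (r0 : 0 <= r) (qF : quasiconcave F) (bF : bounded_support M r F).

Let level_bounded s : 0 <= s -> forall x, s < F x -> `|x| <= r.
Proof.
move=> s0 x sx; rewrite leNgt; apply/negP => /bF.2 Fx; move: sx.
by rewrite Fx ltNge s0.
Qed.

Lemma level_indic s : 0 <= s ->
  mu.-integrable setT (EFin \o \1_[set x | s < F x]) /\
  Rintegral mu setT \1_[set x | s < F x] = len [set x | s < F x].
Proof.
move=> s0; apply: (Rintegral_indic_bounded r) => //.
  exact: is_interval_measurable.
by move=> x /=; exact: level_bounded.
Qed.

Let integrable_staircase (h : R) n : 0 < h ->
  mu.-integrable setT (EFin \o fun x => h * \sum_(k < n) \1_[set x | h * k.+1%:R < F x] x) /\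
  Rintegral mu setT (fun x => h * \sum_(k < n) \1_[set x | h * k.+1%:R < F x] x) =
  h * \sum_(k < n) len [set x | h * k.+1%:R < F x].
Proof.
move=> h0; have hk (k : nat) : 0 <= h * k.+1%:R by rewrite mulr_ge0// ltW.
suff [iS eS] : mu.-integrable setT
    (EFin \o fun x => \sum_(k < n) \1_[set x | h * k.+1%:R < F x] x) /\
  Rintegral mu setT (fun x => \sum_(k < n) \1_[set x | h * k.+1%:R < F x] x) =
  \sum_(k < n) len [set x | h * k.+1%:R < F x].
  split; last by rewrite RintegralZl// eS.
  exact: integrableM_EFin.
elim: n => [|n [IH1 IH2]].
  split.
    have -> : (EFin \o fun x : R => \sum_(k < 0) \1_[set x0 | h * k.+1%:R < F x0] x : R) = cst 0%E.
      by apply/funext => x /=; rewrite big_ord0.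
    exact: integrable0.
  rewrite big_ord0 /Rintegral.
  under eq_integral do rewrite big_ord0.
  by rewrite integral0.
have [iL eL] := level_indic _ (hk n).
have -> : (fun x => \sum_(k < n.+1) \1_[set x | h * k.+1%:R < F x] x) =
  (fun x => \sum_(k < n) \1_[set x | h * k.+1%:R < F x] x + \1_[set x | h * n.+1%:R < F x] x : R).
  by apply/funext => x; rewrite big_ord_recr.
split; last by rewrite RintegralD// IH2 eL big_ord_recr.
exact: integrableD_EFin.
Qed.

Lemma layers_le (h : R) n : 0 < h ->
  h * \sum_(k < n) len [set x | h * k.+1%:R < F x] <= Rintegral mu setT F.
Proof.
move=> h0; have [iS <-] := integrable_staircase _ n h0.
have [iF _] := bounded_support_integrable _ _ _ _ r0 (quasiconcave_measurable _ _ qF) bF.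
apply: le_Rintegral => // x _; have /andP[Fx _] := bF.1 x.
apply: le_trans (staircase_le _ _ n h0 Fx); rewrite ler_pM2l// ler_sum// => k _.
by rewrite indicE; case: ltP => hk; [case: (_ \in _)|rewrite memNset//= ltNge hk].
Qed.

(** The staircase loses at most the height [h], over a support of length at most [2 * r]. *)
Lemma le_layers (h : R) n : 0 < h -> (forall x, F x <= h * n.+1%:R) ->
  Rintegral mu setT F <= h * (2 * r) + h * \sum_(k < n) len [set x | h * k.+1%:R < F x].
Proof.
move=> h0 Fh; have [iS <-] := integrable_staircase _ n h0.
have [iF _] := bounded_support_integrable _ _ _ _ r0 (quasiconcave_measurable _ _ qF) bF.
have [iB <-] := Rintegral_box _ h _ r0.
rewrite -RintegralD//; apply: le_Rintegral => //.
  exact: integrableD_EFin.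
move=> x _; have [xr|xr] := leP `|x| r; last first.
  by rewrite bF.2// addr_ge0// mulr_ge0// ?(ltW h0)// sumr_ge0.
rewrite [\1_`[_, _] _]indicE mem_set/= ?mulr1; last by rewrite in_itv/= -ler_norml.
apply: le_trans (le_staircase _ _ _ h0 (Fh x)) _; rewrite lerD2l ler_pM2l// ler_sum// => k _.
by rewrite indicE; case: ltP => hk //; rewrite mem_set.
Qed.

Lemma level_ubound s : 0 <= s -> has_ubound [set x | s < F x].
Proof. by move=> s0; exists r => x /= /(level_bounded _ s0); rewrite ler_norml => /andP[]. Qed.

Lemma level_lbound s : 0 <= s -> has_lbound [set x | s < F x].
Proof. by move=> s0; exists (- r) => x /= /(level_bounded _ s0); rewrite ler_norml => /andP[]. Qed.

End Layers.

Lemma le_of_harmonic_error (X Y K : R) :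
  (forall n : nat, X <= Y + K / n.+1%:R) -> X <= Y.
Proof.
move=> XY; apply/ler_addgt0Pr => e e0.
pose n := Num.trunc (`|K| / e); have nK : `|K| / e < n.+1%:R by exact: truncnS_gt.
apply: le_trans (XY n) _; rewrite lerD2l ler_pdivrMr ?ltr0n//.
move: nK; rewrite ltr_pdivrMr// mulrC => /ltW; apply: le_trans; exact: ler_norm.
Qed.

(* Levels are normalised by the suprema [a], [b] of [F], [G], so that for [0 <= s < 1] the
   levels [{F > a s}] and [{G > b s}] are both non-empty and their convex combination lies
   in [{H > gmean t a b * s}]. *)
Lemma prekopa_leindler_line (t M r : R) F G H : 0 < t < 1 -> 0 <= r ->
  quasiconcave F -> quasiconcave G -> quasiconcave H ->
  bounded_support M r F -> bounded_support M r G -> bounded_support M r H ->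
  (forall x y, gmean t (F x) (G y) <= H (t * x + (1 - t) * y)) ->
  gmean t (Rintegral mu setT F) (Rintegral mu setT G) <= Rintegral mu setT H.
Proof.
move=> t01 r0 qF qG qH bF bG bH FGH.
have sup_spec K : bounded_support M r K -> Rintegral mu setT K != 0 ->
    0 < sup (range K) /\ (forall x, K x <= sup (range K)) /\
    (forall s, s < sup (range K) -> exists x, s < K x).
  move=> bK nzK.
  have ubK : has_ubound (range K) by exists M => _ [x _ <-]; have /andP[] := bK.1 x.
  have supK : has_sup (range K) by split => //; exists (K 0), 0.
  have le_sup x : K x <= sup (range K) by apply: ub_le_sup => //; exists x.
  split; last split => //; last first.
    by move=> s /(sup_gt supK.1)[_ [x _ <-] sx]; exists x.
  rewrite ltNge; apply/negP => supK0; case/eqP: nzK.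
  rewrite /Rintegral; under eq_integral => x _.
    have -> : K x = 0.
      by apply/le_anti; rewrite (le_trans (le_sup x) supK0); have /andP[] := bK.1 x.
    over.
  by rewrite integral0.
have [F0|nzF] := eqVneq (Rintegral mu setT F) 0.
  by rewrite F0 gmean0l//; apply: Rintegral_ge0 => x _; have /andP[] := bH.1 x.
have [G0|nzG] := eqVneq (Rintegral mu setT G) 0.
  by rewrite G0 gmean0r//; apply: Rintegral_ge0 => x _; have /andP[] := bH.1 x.
have [a0 [Fa aF]] := sup_spec F bF nzF; have [b0 [Gb bG']] := sup_spec G bG nzG.
set a := sup (range F) in a0 Fa aF; set b := sup (range G) in b0 Gb bG'.
set c := gmean t a b; have c0 : 0 < c by exact: gmean_gt0.
have /andP[t0 t1] := t01; have t1' : 0 < 1 - t by rewrite subr_gt0.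
have level (s : R) : 0 <= s -> s < 1 ->
    t * len [set x | a * s < F x] + (1 - t) * len [set x | b * s < G x] <=
    len [set x | c * s < H x].
  move=> s0 s1.
  have as0 : 0 <= a * s by rewrite mulr_ge0// ltW.
  have bs0 : 0 <= b * s by rewrite mulr_ge0// ltW.
  have cs0 : 0 <= c * s by rewrite mulr_ge0// ltW.
  apply: interval_len_combination => //.
  - by apply: aF; rewrite gtr_pMr.
  - by apply: bG'; rewrite gtr_pMr.
  - exact: (level_ubound M r).
  - exact: (level_lbound M r).
  - exact: (level_ubound M r).
  - exact: (level_lbound M r).
  - exact: (level_ubound M r).
  - exact: (level_lbound M r).
  move=> x y /= xF yG; apply: lt_le_trans (FGH x y).
  have -> : c * s = gmean t (a * s) (b * s) by rewrite gmeanM ?(ltW a0) ?(ltW b0)// gmeanxx.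
  exact: gmean_lt.
set A := Rintegral mu setT F; set B := Rintegral mu setT G; set C := Rintegral mu setT H.
have -> : gmean t A B = c * gmean t (A / a) (B / b).
  rewrite /c -gmeanM ?divr_ge0 ?(ltW a0) ?(ltW b0)//; last 2 first.
  - by apply: Rintegral_ge0 => x _; have /andP[] := bF.1 x.
  - by apply: Rintegral_ge0 => x _; have /andP[] := bG.1 x.
  by rewrite ![_ * (_ / _)]mulrC !divfK ?gt_eqF.
(* The inequality between levels bounds an arithmetic mean of integrals; it dominates the geometric
   mean of the normalised integrals, and [c] restores the scale. *)
apply: (@le_trans _ _ (c * (t * (A / a) + (1 - t) * (B / b)))).
  rewrite ler_pM2l//; apply: gmean_le_amean; rewrite ?divr_ge0 ?(ltW a0) ?(ltW b0)//.
  - by apply: Rintegral_ge0 => x _; have /andP[] := bF.1 x.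
  - by apply: Rintegral_ge0 => x _; have /andP[] := bG.1 x.
apply: (@le_of_harmonic_error _ _ (c * (2 * r))) => n.
have n0 : (0 : R) < n.+1%:R by rewrite ltr0n.
pose LF := \sum_(k < n.+1) len [set x | a / n.+1%:R * k.+1%:R < F x].
pose LG := \sum_(k < n.+1) len [set x | b / n.+1%:R * k.+1%:R < G x].
pose LH := \sum_(k < n.+1) len [set x | c / n.+1%:R * k.+1%:R < H x].
have upF : A <= a / n.+1%:R * (2 * r) + a / n.+1%:R * LF.
  apply: (le_layers M r F r0 qF bF); rewrite ?divr_gt0// => x.
  by rewrite (le_trans (Fa x))// mulrAC ler_pdivlMr// ler_pM2l// ler_nat.
have upG : B <= b / n.+1%:R * (2 * r) + b / n.+1%:R * LG.
  apply: (le_layers M r G r0 qG bG); rewrite ?divr_gt0// => x.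
  by rewrite (le_trans (Gb x))// mulrAC ler_pdivlMr// ler_pM2l// ler_nat.
have lowH : c / n.+1%:R * LH <= C.
  by apply: (layers_le M r H r0 qH bH); rewrite divr_gt0.
have mid : t * LF + (1 - t) * LG <= LH.
  rewrite /LF /LG /LH !mulr_sumr -big_split/=; apply: ler_sum => k _.
  have frac (m : R) : m / n.+1%:R * k.+1%:R = m * (k.+1%:R / n.+1%:R) by rewrite mulrAC mulrA.
  rewrite (frac a) (frac b) (frac c).
  have [kn|kn] := ltnP k n.
    by apply: level; rewrite ?divr_ge0// ltr_pdivrMr// mul1r ltr_nat.
  (* At the top index the fraction is 1, outside the range of [level], but the levels of [F] and [G]
     are then empty. *)
  have -> : (k : nat) = n by apply/eqP; rewrite eqn_leq kn -ltnS ltn_ord.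
  rewrite divff ?gt_eqF// !mulr1.
  have empty (K : R -> R) (m : R) : (forall x, K x <= m) -> len [set x | m < K x] = 0.
    move=> Km; suff -> : [set x | m < K x] = set0 by rewrite /len measure0.
    by apply/seteqP; split => x //=; rewrite ltNge Km.
  by rewrite (empty F a)// (empty G b)// !mulr0 addr0 fine_ge0.
have upF' : A / a <= (2 * r) / n.+1%:R + LF / n.+1%:R.
  by rewrite ler_pdivrMr//; move: upF; congr (_ <= _); ring.
have upG' : B / b <= (2 * r) / n.+1%:R + LG / n.+1%:R.
  by rewrite ler_pdivrMr//; move: upG; congr (_ <= _); ring.
have h1 : t * (A / a) + (1 - t) * (B / b) <= (2 * r) / n.+1%:R + LH / n.+1%:R.
  have e1 : t * (A / a) <= t * ((2 * r) / n.+1%:R + LF / n.+1%:R) by rewrite ler_pM2l.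
  have e2 : (1 - t) * (B / b) <= (1 - t) * ((2 * r) / n.+1%:R + LG / n.+1%:R) by rewrite ler_pM2l.
  have e3 : (t * LF + (1 - t) * LG) / n.+1%:R <= LH / n.+1%:R by rewrite ler_pM2r ?invr_gt0.
  apply: le_trans (lerD e1 e2) _; apply: le_trans (lerD (lexx (2 * r / n.+1%:R)) e3).
  by rewrite le_eqVlt; apply/orP; left; apply/eqP; ring.
have h2 : c * (t * (A / a) + (1 - t) * (B / b)) <= c * ((2 * r) / n.+1%:R + LH / n.+1%:R).
  by rewrite ler_pM2l.
apply: le_trans h2 _; rewrite addrC mulrDr.
have -> : c * (LH / n.+1%:R) = c / n.+1%:R * LH by ring.
by rewrite lerD// mulrA.
Qed.

End PrekopaLeindlerLine.
Arguments len {R} A.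

(** * Iterated integrals *)

Section IteratedIntegral.
Variable R : realType.
Local Notation mu := (@lebesgue_measure R).
Implicit Types (f g h : (nat -> R) -> R) (x y : nat -> R).

(** The update occurring in the body of [iint], so that [iintS] holds by conversion. *)
Definition upd (m : nat) (s : R) x : nat -> R := fun i => if i == m then s else x i.
Definition slice (m : nat) f (s : R) : (nat -> R) -> R := fun x => f (upd m s x).
Definition marginal (m : nat) f (s : R) : R := iint m (slice m f s).
Definition comb (t : R) x y : nat -> R := fun i => t * x i + (1 - t) * y i.

Lemma comb_upd m t s s' x y :
  comb t (upd m s x) (upd m s' y) = upd m (t * s + (1 - t) * s') (comb t x y).
Proof. by apply/funext => i; rewrite /comb /upd; case: eqP. Qed.

Lemma iintS m f : iint m.+1 f = Rintegral mu setT (marginal m f).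
Proof. by []. Qed.

(** Slices are required to be integrable for every value of the outer variable, not almost every
    one, so that inductions meet no exceptional null sets. *)
Fixpoint iintegrable (n : nat) f : Prop :=
  match n with
  | 0%N => True
  | m.+1 => (forall s, iintegrable m (slice m f s)) /\
            mu.-integrable setT (EFin \o marginal m f)
  end.

Lemma iintD n f g : iintegrable n f -> iintegrable n g ->
  iintegrable n (fun x => f x + g x) /\ iint n (fun x => f x + g x) = iint n f + iint n g.
Proof.
elim: n f g => [//|m IH] f g [sf If] [sg Ig].
have E s : marginal m (fun x => f x + g x) s = marginal m f s + marginal m g s.
  by have [_ <-] := IH _ _ (sf s) (sg s).
split; last first.
  rewrite !iintS -RintegralD//; apply: eq_Rintegral => s _; exact: E.
split; first by move=> s; have [] := IH _ _ (sf s) (sg s).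
rewrite (_ : marginal m _ = fun s => marginal m f s + marginal m g s); last exact/funext.
exact: integrableD_EFin.
Qed.

Lemma iintZ n (c : R) f : iintegrable n f ->
  iintegrable n (fun x => c * f x) /\ iint n (fun x => c * f x) = c * iint n f.
Proof.
elim: n f => [//|m IH] f [sf If].
have E s : marginal m (fun x => c * f x) s = c * marginal m f s.
  by have [_ <-] := IH _ (sf s).
split; last first.
  rewrite !iintS -RintegralZl//; apply: eq_Rintegral => s _; exact: E.
split; first by move=> s; have [] := IH _ (sf s).
rewrite (_ : marginal m _ = fun s => c * marginal m f s); last exact/funext.
exact: integrableM_EFin.
Qed.

Lemma iint_ge0 n f : (forall x, 0 <= f x) -> 0 <= iint n f.
Proof.
elim: n f => [f f0|m IH f f0]; first exact: f0.
rewrite iintS; apply: Rintegral_ge0 => s _.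
by apply: IH => x; exact: f0.
Qed.

Lemma le_iint n f g : iintegrable n f -> iintegrable n g -> (forall x, f x <= g x) ->
  iint n f <= iint n g.
Proof.
elim: n f g => [f g _ _ fg|m IH f g [sf If] [sg Ig] fg]; first exact: fg.
rewrite !iintS.
by apply: le_Rintegral => // s _; apply: IH; [exact: sf|exact: sg|move=> x; exact: fg].
Qed.

(* [b] vanishes from [n] on because [iint n f] evaluates [f] at functions that are zero there. *)
Lemma iint_affine n (a : R) (b : nat -> R) f : 0 < a -> iintegrable n f ->
  (forall x, 0 <= f x) -> (forall i, (n <= i)%N -> b i = 0) ->
  iintegrable n (fun x => f (fun i => a * x i + b i)) /\
  iint n f = a ^+ n * iint n (fun x => f (fun i => a * x i + b i)).
Proof.
move=> a0; elim: n f b => [|m IH] f b If f0 bn.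
  by rewrite /= expr0 mul1r; split => //; congr f; apply/funext => i; rewrite mulr0 add0r bn.
have [sf iM] := If.
have M0 s : 0 <= marginal m f s by apply: iint_ge0 => x; exact: f0.
have [iG eG] := integrable_affine _ _ a (b m) a0 iM M0.
set F := fun x : nat -> R => f _.
have slF s : iintegrable m (slice m F s) /\ marginal m f (a * s + b m) = a ^+ m * marginal m F s.
  (* Coordinate [m] of the shift is absorbed by the slice; truncating [b] restores the condition
     that the shift vanishes from [m] on. *)
  have := IH (slice m f (a * s + b m)) (fun i => if (i < m)%N then b i else 0).
  have -> : (fun x => slice m f (a * s + b m) (fun i => a * x i + (if (i < m)%N then b i else 0))) =
            slice m F s.
    apply/funext => x; rewrite /slice /F; congr f; apply/funext => i.
    rewrite /upd; case: eqP => [->//|/eqP im]; case: ltnP => // mi.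
    by rewrite bn// ltn_neqAle eq_sym im.
  apply; [exact: sf|by move=> x; exact: f0|].
  by move=> i; rewrite leqNgt => /negbTE ->.
have EF : marginal m F = fun s => (a ^+ m)^-1 * marginal m f (a * s + b m).
  by apply/funext => s; rewrite (slF s).2 mulKf// gt_eqF// exprn_gt0.
split; first by split; [move=> s; exact: (slF s).1|rewrite EF; exact: integrableM_EFin].
rewrite !iintS eG EF RintegralZl// exprS -mulrA; congr (_ * _).
by rewrite mulVKf// gt_eqF// exprn_gt0.
Qed.

Lemma iint_cube n (rho : R) f : 0 <= rho -> iintegrable n f -> (forall x, 0 <= f x) ->
  (forall x, (forall i, `|x i| <= rho) -> (forall i, (n <= i)%N -> x i = 0) -> 1 <= f x) ->
  (2 * rho) ^+ n <= iint n f.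
Proof.
move=> rho0; elim: n f => [|m IH] f If f0 f1.
  by rewrite expr0 /=; apply: f1 => // i; rewrite normr0.
have [sf iM] := If.
have [iB eB] := Rintegral_box R ((2 * rho) ^+ m) rho rho0.
rewrite iintS exprSr -eB; apply: le_Rintegral => // s _.
have [srho|srho] := leP `|s| rho; last first.
  rewrite [\1_(`[_, _]) _]indicE memNset ?mulr0; first by apply: iint_ge0 => x; exact: f0.
  by rewrite /= in_itv/= -ler_norml leNgt srho.
rewrite [\1_(`[_, _]) _]indicE mem_set/= ?mulr1; last by rewrite in_itv/= -ler_norml.
apply: IH; [exact: sf|by move=> x; exact: f0|move=> x xrho xm].
apply: f1 => i; rewrite /upd; first by case: eqP.
by move=> mi; rewrite gtn_eqF// xm// ltnW.
Qed.

(** Powers instead of logarithms allow [f] to vanish: for 0 < t < 1 the mean is 0 as soon as one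
    value is. *)
Definition log_concave f := (forall x, 0 <= f x) /\
  forall t x y, 0 < t < 1 -> gmean t (f x) (f y) <= f (comb t x y).

Definition box_bounded (n : nat) (M r : R) f :=
  (forall x, f x <= M) /\ (forall x i, (i < n)%N -> r < `|x i| -> f x = 0).

Lemma log_concave_slice m f s : log_concave f -> log_concave (slice m f s).
Proof.
move=> [f0 fc]; split=> [x|t x y t01]; first exact: f0.
apply: le_trans (fc _ _ _ t01) _; rewrite comb_upd /slice.
by rewrite (_ : t * s + (1 - t) * s = s)//; ring.
Qed.

Lemma box_bounded_slice m M r f s : box_bounded m.+1 M r f -> box_bounded m M r (slice m f s).
Proof.
move=> [fM fr]; split=> [x|x i im ri]; first exact: fM.
by apply: (fr _ i); rewrite ?ltnS 1?ltnW// /upd ltn_eqF.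
Qed.

(** A geometric mean is at least the minimum, so superlevel sets are intervals. *)
Lemma log_concave_quasiconcave (F : R -> R) : (forall s, 0 <= F s) ->
  (forall t s s', 0 < t < 1 -> gmean t (F s) (F s') <= F (t * s + (1 - t) * s')) ->
  quasiconcave F.
Proof.
move=> F0 Fc c s s' /= sF s'F z /andP[sz zs'].
have [<-//|nsz] := eqVneq s z; have [->//|nzs'] := eqVneq z s'.
have {nsz}sz : s < z by rewrite lt_neqAle nsz.
have {nzs'}zs' : z < s' by rewrite lt_neqAle nzs'.
pose t := (s' - z) / (s' - s).
have ss' : 0 < s' - s by rewrite subr_gt0 (lt_trans sz).
have t01 : 0 < t < 1.
  apply/andP; split; first by rewrite divr_gt0// subr_gt0.
  by rewrite ltr_pdivrMr// mul1r ltrD2l ltrN2.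
have -> : z = t * s + (1 - t) * s' by rewrite /t; field; rewrite gt_eqF.
apply: lt_le_trans (Fc _ _ _ t01); apply: lt_le_trans (minr_le_gmean _ _ _ _ t01 (F0 _) (F0 _)).
by rewrite lt_min sF.
Qed.

(* The inequality in dimension [n] makes the marginals of dimension [n + 1] log-concave, hence
   measurable (their superlevel sets are intervals), and this yields integrability without any
   product sigma-algebra; both statements are therefore proved by one induction. *)
Definition prekopa_leindler_at (n : nat) := forall (t M r : R) f g h, 0 < t < 1 -> 0 <= r ->
  log_concave f -> log_concave g -> log_concave h ->
  box_bounded n M r f -> box_bounded n M r g -> box_bounded n M r h ->
  (forall x y, gmean t (f x) (g y) <= h (comb t x y)) ->
  gmean t (iint n f) (iint n g) <= iint n h.

Definition integrable_at (n : nat) := forall (M r : R) f, 0 <= r ->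
  log_concave f -> box_bounded n M r f ->
  iintegrable n f /\ iint n f <= M * (2 * r) ^+ n.

(** Prekopa's theorem: the slices at [s], [s'] and their combination satisfy the hypothesis of the
    inequality in dimension [m]. *)
Lemma marginal_log_concave m (M r : R) f : prekopa_leindler_at m -> integrable_at m -> 0 <= r ->
  log_concave f -> box_bounded m.+1 M r f ->
  quasiconcave (marginal m f) /\ bounded_support (M * (2 * r) ^+ m) r (marginal m f).
Proof.
move=> PL I r0 fc fb; have lc := log_concave_slice m f ^~ fc.
have bb := box_bounded_slice m M r f ^~ fb.
have M0 s : 0 <= marginal m f s by apply: iint_ge0 => x; exact: (lc s).1.
split.
  apply: log_concave_quasiconcave => // t s s' t01.
  apply: (PL t M r) => // x y; rewrite /slice -comb_upd; exact: fc.2.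
split=> [s|s rs]; first by rewrite M0; exact: (I M r _ r0 (lc s) (bb s)).2.
apply/le_anti; rewrite M0 andbT.
(* Beyond [r] the slice vanishes identically, so [I] applies with 0 in place of [M]. *)
rewrite -(mul0r ((2 * r) ^+ m)); apply: (I 0 r _ r0 (lc s) _).2.
split=> [x|x i im]; last exact: (bb s).2.
by rewrite /slice (fb.2 _ m)// /upd eqxx.
Qed.

(** The inequality in dimension [m], applied to slices, is the pointwise hypothesis of the line case
    for the marginals. *)
Lemma prekopa_leindler_integrable n : prekopa_leindler_at n /\ integrable_at n.
Proof.
elim: n => [|m [PL I]].
  split=> [t M r f g h t01 r0 _ _ _ _ _ _ fgh|M r f r0 fc fb] /=.
    apply: le_trans (fgh _ _) _; rewrite (_ : comb _ _ _ = fun=> 0)//.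
    by apply/funext => i; rewrite /comb !mulr0 addr0.
  by rewrite expr0 mulr1; split => //; exact: fb.1.
split=> [t M r f g h t01 r0 fc gc hc fb gb hb fgh|M r f r0 fc fb].
  have [qf bf] := marginal_log_concave _ _ _ _ PL I r0 fc fb.
  have [qg bg] := marginal_log_concave _ _ _ _ PL I r0 gc gb.
  have [qh bh] := marginal_log_concave _ _ _ _ PL I r0 hc hb.
  rewrite !iintS; apply: (prekopa_leindler_line _ _ (M * (2 * r) ^+ m) r) => // s s'.
  apply: (PL t M r) => //; try exact: log_concave_slice; try exact: box_bounded_slice.
  by move=> x y; rewrite /slice -comb_upd.
have [qf bf] := marginal_log_concave _ _ _ _ PL I r0 fc fb.
have [i1 /andP[_ i2]] := bounded_support_integrable _ _ _ _ r0 (quasiconcave_measurable _ _ qf) bf.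
split; last by rewrite iintS exprSr mulrA.
split => // s; apply: (I M r _ r0 _ _).1; [exact: log_concave_slice|exact: box_bounded_slice].
Qed.

End IteratedIntegral.
Arguments iintegrable {R} n f.
Arguments log_concave {R} f.
Arguments box_bounded {R} n M r f.
Arguments comb {R} t x y.

(** * Row vectors and integrands carried by convex sets *)

Section VectorIntegral.
Variables (R : realType) (d : nat).
Local Notation vec := 'rV[R]_d.
Implicit Types (F G H L : vec -> R) (K : set vec) (x y : vec).

Let rowv (g : nat -> R) : vec := \row_(i < d) g (nat_of_ord i).

Let rowv_comb t (g g' : nat -> R) : rowv (comb t g g') = t *: rowv g + (1 - t) *: rowv g'.
Proof. by apply/rowP => i; rewrite !mxE. Qed.

Definition vintegrable F := iintegrable d (fun g => F (\row_(i < d) g (nat_of_ord i))).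

Definition vlog_concave F := (forall x, 0 <= F x) /\
  forall t x y, 0 < t < 1 -> gmean t (F x) (F y) <= F (t *: x + (1 - t) *: y).

Definition vbounded (M r : R) F :=
  (forall x, F x <= M) /\ (forall x i, r < `|x 0 i| -> F x = 0).

Lemma vintegrableD F G : vintegrable F -> vintegrable G -> vintegrable (fun x => F x + G x).
Proof. by move=> iF iG; have [] := iintD _ _ _ _ iF iG. Qed.

Lemma integral_RdD F G : vintegrable F -> vintegrable G ->
  integral_Rd (fun x => F x + G x) = integral_Rd F + integral_Rd G.
Proof. by move=> iF iG; have [] := iintD _ _ _ _ iF iG. Qed.

Lemma vintegrableZ (c : R) F : vintegrable F -> vintegrable (fun x => c * F x).
Proof. by move=> iF; have [] := iintZ _ _ c _ iF. Qed.

Lemma integral_RdZ (c : R) F : vintegrable F ->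
  integral_Rd (fun x => c * F x) = c * integral_Rd F.
Proof. by move=> iF; have [] := iintZ _ _ c _ iF. Qed.

Lemma le_integral_Rd F G : vintegrable F -> vintegrable G -> (forall x, F x <= G x) ->
  integral_Rd F <= integral_Rd G.
Proof. by move=> iF iG FG; apply: le_iint => // g; exact: FG. Qed.

Lemma integral_Rd_ge0 F : (forall x, 0 <= F x) -> 0 <= integral_Rd F.
Proof. by move=> F0; apply: iint_ge0 => g; exact: F0. Qed.

Lemma integral_Rd_affine (a : R) (b : vec) F : 0 < a -> vintegrable F ->
  (forall x, 0 <= F x) ->
  vintegrable (fun x => F (a *: x + b)) /\
  integral_Rd F = a ^+ d * integral_Rd (fun x => F (a *: x + b)).
Proof.
move=> a0 iF F0.
pose b' (i : nat) : R := if insub i is Some j then b 0 j else 0.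
have b'E (i : 'I_d) : b' i = b 0 i by rewrite /b' valK.
have := iint_affine _ d a b' _ a0 iF (fun g => F0 _).
rewrite (_ : (fun g => F _) = (fun g => F (a *: (\row_(i < d) g (nat_of_ord i)) + b))).
  by apply => i di; rewrite /b' insubF// ltnNge di.
by apply/funext => g; congr F; apply/rowP => i; rewrite !mxE b'E.
Qed.

Lemma cube_le_integral_Rd (rho : R) F : 0 <= rho -> vintegrable F -> (forall x, 0 <= F x) ->
  (forall x, (forall i, `|x 0 i| <= rho) -> 1 <= F x) ->
  (2 * rho) ^+ d <= integral_Rd F.
Proof.
move=> rho0 iF F0 F1; apply: iint_cube => // g grho _.
by apply: F1 => i; rewrite mxE.
Qed.

Let lift_log_concave F : vlog_concave F -> log_concave (F \o rowv).
Proof.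
move=> [F0 Fc]; split=> [g|t g g' t01] /=; first exact: F0.
by rewrite rowv_comb; exact: Fc.
Qed.

Let lift_bounded M r F : vbounded M r F -> box_bounded d M r (F \o rowv).
Proof.
move=> [FM Fr]; split=> [g|g i id rg] /=; first exact: FM.
by apply: (Fr _ (Ordinal id)); rewrite mxE.
Qed.

Lemma vlog_concave_integrable M r F : 0 <= r -> vlog_concave F -> vbounded M r F ->
  vintegrable F.
Proof.
move=> r0 /lift_log_concave Fc /lift_bounded Fb.
exact: ((prekopa_leindler_integrable R d).2 M r _ r0 Fc Fb).1.
Qed.

Lemma prekopa_leindler t M r F G H : 0 < t < 1 -> 0 <= r ->
  vlog_concave F -> vlog_concave G -> vlog_concave H ->
  vbounded M r F -> vbounded M r G -> vbounded M r H ->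
  (forall x y, gmean t (F x) (G y) <= H (t *: x + (1 - t) *: y)) ->
  gmean t (integral_Rd F) (integral_Rd G) <= integral_Rd H.
Proof.
move=> t01 r0 /lift_log_concave Fc /lift_log_concave Gc /lift_log_concave Hc.
move=> /lift_bounded Fb /lift_bounded Gb /lift_bounded Hb FGH.
apply: ((prekopa_leindler_integrable R d).1 t M r _ _ _ t01 r0 Fc Gc Hc Fb Gb Hb) => g g' /=.
by rewrite rowv_comb.
Qed.

Definition convex K := forall t x y, 0 < t < 1 -> K x -> K y -> K (t *: x + (1 - t) *: y).

Definition concave_on K L := forall t x y, 0 < t < 1 -> K x -> K y ->
  t * L x + (1 - t) * L y <= L (t *: x + (1 - t) *: y).

Lemma indic_in K x : K x -> indic K x = 1 :> R.
Proof. by move=> Kx; rewrite /indic asboolT. Qed.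

Lemma indic_notin K x : ~ K x -> indic K x = 0 :> R.
Proof. by move=> Kx; rewrite /indic asboolF. Qed.

Lemma indic_ge0 K x : (0 : R) <= indic K x.
Proof. by rewrite /indic; case: ifP. Qed.

Lemma indic_le1 K x : indic K x <= (1 : R).
Proof. by rewrite /indic; case: ifP. Qed.

(** On [K] the geometric mean is below the arithmetic one, hence below the concave [L]; if a point
    lies outside [K] the mean is 0. *)
Lemma vlog_concave_restrict K L : convex K -> concave_on K L -> (forall x, K x -> 0 <= L x) ->
  vlog_concave (fun x => indic K x * L x).
Proof.
move=> cK cL L0; have P0 x : 0 <= indic K x * L x.
  by have [Kx|Kx] := pselect (K x); [rewrite indic_in// mul1r L0|rewrite indic_notin// mul0r].
split => // t x y t01.
have [Kx|Kx] := pselect (K x); last by rewrite (indic_notin _ _ Kx) mul0r gmean0l.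
have [Ky|Ky] := pselect (K y); last by rewrite (indic_notin _ _ Ky) mul0r gmean0r.
rewrite !indic_in//; last exact: cK.
rewrite !mul1r; apply: le_trans (cL _ _ _ t01 Kx Ky).
by apply: gmean_le_amean; rewrite ?L0.
Qed.

Lemma vlog_concave_indic K : convex K -> vlog_concave (indic K).
Proof.
move=> cK; rewrite (_ : indic K = fun x => indic K x * 1).
  apply: vlog_concave_restrict => // t x y t01 _ _.
  by rewrite !mulr1 addrC subrK.
by apply/funext => x; rewrite mulr1.
Qed.

Lemma vbounded_restrict K L M r : 0 <= M -> (forall x i, K x -> `|x 0 i| <= r) ->
  (forall x, K x -> L x <= M) -> vbounded M r (fun x => indic K x * L x).
Proof.
move=> M0 Kr LM; split=> [x|x i rx].
  by have [Kx|Kx] := pselect (K x); [rewrite indic_in// mul1r LM|rewrite indic_notin// mul0r].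
by rewrite indic_notin ?mul0r// => /Kr => /(_ i); rewrite leNgt rx.
Qed.

Lemma vbounded_indic K r : (forall x i, K x -> `|x 0 i| <= r) -> vbounded 1 r (indic K).
Proof.
move=> Kr; split=> [x|x i rx]; first exact: indic_le1.
by rewrite indic_notin// => /Kr => /(_ i); rewrite leNgt rx.
Qed.

Lemma vintegrable_indic K r : 0 <= r -> convex K -> (forall x i, K x -> `|x 0 i| <= r) ->
  vintegrable (indic K).
Proof.
move=> r0 cK Kr; apply: (vlog_concave_integrable 1 r) => //.
  exact: vlog_concave_indic.
exact: vbounded_indic.
Qed.

Lemma vintegrable_restrict K L M r : 0 <= M -> 0 <= r -> convex K -> concave_on K L ->
  (forall x i, K x -> `|x 0 i| <= r) -> (forall x, K x -> 0 <= L x <= M) ->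
  vintegrable (fun x => indic K x * L x).
Proof.
move=> M0 r0 cK cL Kr LM; apply: (vlog_concave_integrable M r) => //.
  by apply: vlog_concave_restrict => // x /LM/andP[].
by apply: vbounded_restrict => // x /LM/andP[].
Qed.

Lemma vintegrable_sum (n : nat) (F : 'I_n -> vec -> R) : (forall k, vintegrable (F k)) ->
  vintegrable (fun x => \sum_(k < n) F k x) /\
  integral_Rd (fun x => \sum_(k < n) F k x) = \sum_(k < n) integral_Rd (F k).
Proof.
elim: n F => [|n IH] F iF.
  have i1 : vintegrable (indic set0).
    by apply: (vintegrable_indic _ 0) => // t x y t01.
  have -> : (fun x => \sum_(k < 0) F k x) = (fun x => 0 * indic set0 x).
    by apply/funext => x; rewrite big_ord0 mul0r.
  by rewrite integral_RdZ// mul0r big_ord0; split => //; exact: vintegrableZ.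
have -> : (fun x => \sum_(k < n.+1) F k x) =
  (fun x => \sum_(k < n) F (widen_ord (leqnSn n) k) x + F ord_max x).
  by apply/funext => x; rewrite big_ord_recr.
have [i1 e1] := IH (fun k => F (widen_ord (leqnSn n) k)) (fun k => iF _).
by split; [exact: vintegrableD|rewrite integral_RdD// e1 big_ord_recr].
Qed.

End VectorIntegral.
Arguments vintegrable {R d} F.
Arguments vlog_concave {R d} F.
Arguments vbounded {R d} M r F.
Arguments convex {R d} K.
Arguments concave_on {R d} K L.

(** * Cutting a convex body near its centroid *)

Section Euclidean.
Variables (R : realType) (d : nat).
Implicit Types (u v w x y : 'rV[R]_d).

Lemma dotpDl u w v : dotp (u + w) v = dotp u v + dotp w v.
Proof. by rewrite /dotp -big_split; apply: eq_bigr => i _; rewrite mxE mulrDl. Qed.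

Lemma dotpZl (c : R) u v : dotp (c *: u) v = c * dotp u v.
Proof. by rewrite /dotp mulr_sumr; apply: eq_bigr => i _; rewrite mxE mulrA. Qed.

Lemma dotpNl u v : dotp (- u) v = - dotp u v.
Proof. by rewrite -scaleN1r dotpZl mulN1r. Qed.

Lemma dotpBl u w v : dotp (u - w) v = dotp u v - dotp w v.
Proof. by rewrite dotpDl dotpNl. Qed.

Lemma sumsq_ge0 x : 0 <= \sum_(i < d) x 0 i ^+ 2.
Proof. by apply: sumr_ge0 => i _; exact: sqr_ge0. Qed.

Lemma norm2_ge0 x : 0 <= norm2 x.
Proof. exact: sqrtr_ge0. Qed.

Lemma sqr_norm2 x : norm2 x ^+ 2 = \sum_(i < d) x 0 i ^+ 2.
Proof. by rewrite sqr_sqrtr// sumsq_ge0. Qed.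

Lemma cauchy_schwarz u v : dotp u v ^+ 2 <= norm2 u ^+ 2 * norm2 v ^+ 2.
Proof.
rewrite !sqr_norm2; set A := \sum_(i < d) u 0 i ^+ 2; set B := \sum_(i < d) v 0 i ^+ 2.
set C := dotp u v.
have : 0 <= \sum_(i < d) (B * u 0 i - C * v 0 i) ^+ 2.
  by apply: sumr_ge0 => i _; exact: sqr_ge0.
have -> : \sum_(i < d) (B * u 0 i - C * v 0 i) ^+ 2 = B * (A * B - C ^+ 2).
  transitivity (B ^+ 2 * A + (- 2 * B * C) * C + C ^+ 2 * B); last by ring.
  have -> : B ^+ 2 * A = \sum_(i < d) B ^+ 2 * u 0 i ^+ 2 by rewrite /A mulr_sumr.
  have -> : - 2 * B * C * C = \sum_(i < d) (- 2 * B * C) * (u 0 i * v 0 i).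
    by rewrite -mulr_sumr.
  have -> : C ^+ 2 * B = \sum_(i < d) C ^+ 2 * v 0 i ^+ 2 by rewrite /B mulr_sumr.
  rewrite -!big_split/=; apply: eq_bigr => i _; ring.
have [B0|nzB] := eqVneq B 0.
  move=> _; suff -> : C = 0 by rewrite expr2 mul0r B0 mulr0.
  rewrite /C /dotp big1// => i _.
  have : v 0 i ^+ 2 = 0 by apply: (psumr_eq0P _ B0) => // j _; exact: sqr_ge0.
  by move/eqP; rewrite sqrf_eq0 => /eqP ->; rewrite mulr0.
have B0 : 0 < B by rewrite lt_neqAle eq_sym nzB sumsq_ge0.
by rewrite pmulr_rge0// subr_ge0.
Qed.

Lemma dotp_le_norm2 u v : `|dotp u v| <= norm2 u * norm2 v.
Proof.
rewrite -(@ler_pXn2r _ 2)// ?nnegrE ?mulr_ge0 ?norm2_ge0//.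
by rewrite exprMn real_normK ?num_real// cauchy_schwarz.
Qed.

Lemma coord_le_norm2 x i : `|x 0 i| <= norm2 x.
Proof.
rewrite -(@ler_pXn2r _ 2)// ?nnegrE ?norm2_ge0// real_normK ?num_real// sqr_norm2.
by rewrite (bigD1 i)//= lerDl sumr_ge0// => j _; exact: sqr_ge0.
Qed.

Lemma norm2Z (c : R) x : norm2 (c *: x) = `|c| * norm2 x.
Proof.
rewrite /norm2 -sqrtr_sqr -sqrtrM ?sqr_ge0// mulr_sumr; congr Num.sqrt.
by apply: eq_bigr => i _; rewrite mxE exprMn.
Qed.

Lemma norm2D x y : norm2 (x + y) <= norm2 x + norm2 y.
Proof.
rewrite -(@ler_pXn2r _ 2)// ?nnegrE ?addr_ge0 ?norm2_ge0//.
have -> : norm2 (x + y) ^+ 2 = norm2 x ^+ 2 + norm2 y ^+ 2 + 2 * dotp x y.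
  rewrite !sqr_norm2 /dotp mulr_sumr -!big_split/=; apply: eq_bigr => i _.
  by rewrite mxE; ring.
have := le_trans (ler_norm _) (dotp_le_norm2 x y); lra.
Qed.

Lemma convex_ball (r : R) : convex (@ballB R d r).
Proof.
move=> t x y /andP[t0 t1]; rewrite /ballB /= => xr yr.
have t1' : 0 < 1 - t by rewrite subr_gt0.
apply: le_trans (norm2D _ _) _; rewrite !norm2Z !gtr0_norm//.
have : t * norm2 x <= t * r by rewrite ler_pM2l.
have : (1 - t) * norm2 y <= (1 - t) * r by rewrite ler_pM2l.
lra.
Qed.

Lemma convex_minkowski (A B : set 'rV[R]_d) : convex A -> convex B ->
  convex (minkowski A B).
Proof.
move=> cA cB t _ _ t01 [a [b [Aa [Bb ->]]]] [a' [b' [Aa' [Bb' ->]]]].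
exists (t *: a + (1 - t) *: a'), (t *: b + (1 - t) *: b'); split; first exact: cA.
by split; [exact: cB|rewrite !scalerDr addrACA].
Qed.

End Euclidean.

Section CentroidCut.
Variables (R : realType) (d : nat).
Variables (K : set 'rV[R]_d) (r : R) (v w : 'rV[R]_d).
Hypotheses (r0 : 0 <= r) (cK : convex K) (Kr : forall x i, K x -> `|x 0 i| <= r).
Hypotheses (V0 : 0 < vol K) (Kw : K w).

Let V := vol K.
Let Y x : R := dotp (x - cg K) v.
(** Crude: it serves for integrability and to limit the number of tails, and does not enter the
    final estimates. *)
Let bound : R := \sum_(i < d) (r + `|cg K 0 i|) * `|v 0 i|.

Let Y_affine t x y : Y (t *: x + (1 - t) *: y) = t * Y x + (1 - t) * Y y.
Proof. by rewrite /Y !(dotpBl, dotpDl, dotpZl); ring. Qed.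

Let bound_ge0 : 0 <= bound.
Proof. by apply: sumr_ge0 => i _; rewrite mulr_ge0// addr_ge0. Qed.

Let Y_bound x : K x -> `|Y x| <= bound.
Proof.
move=> Kx; apply: le_trans (ler_norm_sum _ _ _) _; apply: ler_sum => i _.
rewrite normrM ler_wpM2r// !mxE (le_trans (ler_normB _ _))// lerD2r; exact: Kr.
Qed.

(** A coordinate may change sign, so it is shifted by [r] to be nonnegative on [K], and the shift is
    subtracted again. *)
Lemma vintegrable_coord i : vintegrable (fun x => indic K x * x 0 i).
Proof.
have -> : (fun x : 'rV[R]_d => indic K x * x 0 i) =
  (fun x => indic K x * (x 0 i + r) + - r * indic K x) by apply/funext => x; ring.
apply: vintegrableD.
  apply: (vintegrable_restrict _ _ _ _ (2 * r) r) => //; first by rewrite mulr_ge0.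
    by move=> t x y _ _ _; rewrite !mxE le_eqVlt; apply/orP; left; apply/eqP; ring.
  move=> x /Kr => /(_ i); rewrite ler_norml => /andP[h1 h2]; apply/andP; split; lra.
exact/vintegrableZ/(vintegrable_indic _ _ _ r).
Qed.

Let iK : vintegrable (indic K).
Proof. exact: (vintegrable_indic _ _ _ r). Qed.

(** The only place where the defining formula of [cg] is used. *)
Lemma centroid_moment :
  vintegrable (fun x => indic K x * Y x) /\ integral_Rd (fun x => indic K x * Y x) = 0.
Proof.
have -> : (fun x => indic K x * Y x) =
  (fun x => (\sum_(i < d) v 0 i * (indic K x * x 0 i)) + - dotp (cg K) v * indic K x).
  apply/funext => x; rewrite /Y dotpBl mulrBr mulNr [dotp _ _ * indic _ _]mulrC; congr (_ - _).
  by rewrite /dotp mulr_sumr; apply: eq_bigr => i _; ring.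
have iC i : vintegrable (fun x => v 0 i * (indic K x * x 0 i)).
  exact/vintegrableZ/vintegrable_coord.
have [iS eS] := vintegrable_sum _ _ _ _ iC.
split; first by apply: vintegrableD => //; exact: vintegrableZ.
rewrite integral_RdD//; last exact: vintegrableZ.
rewrite eS integral_RdZ// -/(vol K) mulNr; apply/eqP; rewrite subr_eq0; apply/eqP.
rewrite /dotp mulr_suml; apply: eq_bigr => i _.
rewrite integral_RdZ; last exact: vintegrable_coord.
by rewrite /cg mxE; field; rewrite gt_eqF.
Qed.

Lemma centroid_lower_bound (c : R) : (forall x, K x -> c <= Y x) -> c <= 0.
Proof.
move=> cY; have [iY eY] := centroid_moment.
rewrite -(ler_pM2r V0) mul0r -eY -integral_RdZ//; apply: le_integral_Rd => // [|x].
  exact: vintegrableZ.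
have [Kx|Kx] := pselect (K x); last by rewrite !indic_notin// mulr0 mul0r.
by rewrite !indic_in// mulr1 mul1r cY.
Qed.

Let pos x : R := indic K x * Num.max (Y x) 0.
Let neg x : R := indic K x * Num.max (- Y x) 0.

(** A positive part is convex rather than concave; it is therefore rewritten as the affine [L] cut
    off to the convex set where [L] is nonnegative. *)
Let integrable_max (L : 'rV[R]_d -> R) :
  (forall t x y, L (t *: x + (1 - t) *: y) = t * L x + (1 - t) * L y) ->
  (forall x, K x -> L x <= bound) ->
  vintegrable (fun x => indic K x * Num.max (L x) 0).
Proof.
move=> La Lb.
have -> : (fun x => indic K x * Num.max (L x) 0) =
  (fun x => indic (K `&` [set x | 0 <= L x]) x * L x).
  apply/funext => x; have [Kx|Kx] := pselect (K x); last first.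
    by rewrite !indic_notin ?mul0r// => -[].
  have [L0|L0] := leP 0 (L x).
    by rewrite !indic_in// max_l.
  rewrite indic_in// (@indic_notin _ _ (_ `&` _)) ?max_r ?mulr0 ?mul0r// ?ltW//.
  by move=> [_ /=]; rewrite leNgt L0.
apply: (vintegrable_restrict _ _ _ _ bound r) => //.
- move=> t x y t01 [Kx Lx] [Ky Ly]; split; first exact: cK.
  have /andP[t0 t1] := t01.
  by rewrite /= La addr_ge0// mulr_ge0// ?subr_ge0 ltW.
- by move=> t x y _ _ _; rewrite La.
- by move=> x i [Kx _]; exact: Kr.
- by move=> x [Kx Lx]; rewrite Lb// andbT.
Qed.

Let iP : vintegrable pos.
Proof. by apply: integrable_max => // x /Y_bound; rewrite ler_norml => /andP[]. Qed.

Let iN : vintegrable neg.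
Proof.
apply: integrable_max => [t x y|x /Y_bound]; first by rewrite Y_affine; ring.
by rewrite ler_norml lerNl => /andP[].
Qed.

Let N := integral_Rd pos.

Let N_neg : integral_Rd neg = N.
Proof.
have [iY eY] := centroid_moment.
have := integral_RdD _ _ _ _ iN iY; rewrite eY addr0 => <-; congr integral_Rd.
apply/funext => x; rewrite /pos /neg -mulrDr; congr (_ * _).
have [Y0|/ltW Y0] := leP 0 (Y x).
  by rewrite [Num.max (- Y x) 0]max_r ?oppr_le0// add0r.
by rewrite [Num.max (- Y x) 0]max_l ?oppr_ge0// addNr.
Qed.

(* Compare [pos] with its image under the homothety of centre [w] and ratio [d/(d+1)]. *)
Lemma centroid_pos_part_ge : (0 < d)%N -> Y w * V <= 2 * expR 1 * d%:R * N.
Proof.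
move=> d0; have N0 : 0 <= N.
  by apply: integral_Rd_ge0 => x; rewrite mulr_ge0 ?indic_ge0// le_max lexx orbT.
have dR : (1 : R) <= d%:R by rewrite ler1n.
have dp : (0 : R) < d%:R by rewrite ltr0n.
have [Yw|Yw] := leP (Y w) 0.
  apply: (@le_trans _ _ 0); first by rewrite mulr_le0_ge0// ltW.
  by rewrite !mulr_ge0// expR_ge0.
pose th : R := d%:R / (d%:R + 1).
have th01 : 0 < th < 1.
  by apply/andP; split; rewrite /th ?divr_gt0 ?addr_gt0// ltr_pdivrMr ?addr_gt0// mul1r ltrDl.
have /andP[th0 th1] := th01.
have P0 x : 0 <= pos x by rewrite mulr_ge0 ?indic_ge0// le_max lexx orbT.
have [iPa eP] := integral_Rd_affine _ _ th ((1 - th) *: w) _ th0 iP P0.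
have [iY eY] := centroid_moment.
(* The homothety keeps [K] inside [K], where [pos] is at least the affine [Y]; the contribution of
   [th * Y x] integrates to 0. *)
have low : (1 - th) * Y w * V <= integral_Rd (fun x => pos (th *: x + (1 - th) *: w)).
  have -> : (1 - th) * Y w * V =
      integral_Rd (fun x => th * (indic K x * Y x) + (1 - th) * Y w * indic K x).
    by rewrite integral_RdD ?integral_RdZ ?eY ?mulr0 ?add0r//; exact: vintegrableZ.
  apply: le_integral_Rd => // [|x]; first by apply: vintegrableD; exact: vintegrableZ.
  have [Kx|Kx] := pselect (K x); last by rewrite indic_notin// mul0r !mulr0 addr0 P0.
  rewrite /pos !indic_in//; last exact: cK.
  by rewrite !mul1r mulr1 Y_affine le_max lexx.
(* The volume factor costs only [expR 1], since exp(1/d) >= 1 + 1/d = 1/th. *)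
have thd : 1 <= expR 1 * th ^+ d.
  have -> : expR 1 = expR (d%:R^-1) ^+ d :> R.
    by rewrite -expRM_natl mulfV// gt_eqF.
  rewrite -exprMn; apply: exprn_ege1.
  apply: le_trans (ler_wpM2r (ltW th0) (expR_ge1Dx _)).
  by rewrite /th le_eqVlt; apply/orP; left; apply/eqP; field; rewrite !gt_eqF// addr_gt0.
have thN : th ^+ d * ((1 - th) * Y w * V) <= N by rewrite /N eP ler_pM2l// exprn_gt0.
(* Here 1 - th = 1/(d + 1) >= 1/(2d), the origin of the factor 2d. *)
have th1' : 1 <= 2 * d%:R * (1 - th).
  have -> : 1 - th = (d%:R + 1)^-1 by rewrite /th; field; rewrite gt_eqF// addr_gt0.
  by rewrite ler_pdivlMr ?addr_gt0// mul1r; lra.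
have YV : 0 <= Y w * V by rewrite mulr_ge0// ltW.
have e1 : 1 <= 2 * d%:R * (1 - th) * (expR 1 * th ^+ d) by rewrite -[leLHS]mulr1 ler_pM.
have e2 : Y w * V <= 2 * d%:R * (1 - th) * (expR 1 * th ^+ d) * (Y w * V).
  by rewrite -[leLHS]mul1r ler_wpM2r.
apply: le_trans e2 _.
have -> : 2 * d%:R * (1 - th) * (expR 1 * th ^+ d) * (Y w * V) =
  2 * expR 1 * d%:R * (th ^+ d * ((1 - th) * Y w * V)) by ring.
by rewrite ler_wpM2l// !mulr_ge0// expR_ge0.
Qed.

Let tail y : R := vol (K `&` [set x | Y x < y]).

Let convex_tail y : convex (K `&` [set x | Y x < y]).
Proof.
move=> t x x' t01 [Kx xy] [Kx' xy']; split; first exact: cK.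
have /andP[t0 t1] := t01; have t1' : 0 < 1 - t by rewrite subr_gt0.
rewrite /= Y_affine; move: xy xy' => /=.
by rewrite -(ltr_pM2l t0) -[Y x' < y](ltr_pM2l t1'); lra.
Qed.

Let tail_coord y x i : (K `&` [set x | Y x < y]) x -> `|x 0 i| <= r.
Proof. by move=> [Kx _]; exact: Kr. Qed.

Let iT y : vintegrable (indic (K `&` [set x | Y x < y])).
Proof. by apply: (vintegrable_indic _ _ _ r) => // x i; exact: tail_coord. Qed.

Let tail_ge0 y : 0 <= tail y.
Proof. by apply: integral_Rd_ge0 => x; exact: indic_ge0. Qed.

Lemma indic_le (A B : set 'rV[R]_d) x : A `<=` B -> indic A x <= indic B x :> R.
Proof.
move=> AB; have [Ax|Ax] := pselect (A x); first by rewrite !indic_in//; exact: AB.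
by rewrite indic_notin// indic_ge0.
Qed.

Let tail_mono y y' : y <= y' -> tail y <= tail y'.
Proof.
move=> yy'; apply: le_integral_Rd => // x; apply: indic_le => z [Kz zy]; split => //=.
exact: lt_le_trans yy'.
Qed.

(** Prekopa-Leindler at t = 1/2 for three indicators: a midpoint between {Y < y - D} and {Y < y + D}
    lies in {Y < y}. *)
Let tail_log_concave y D : tail (y - D) * tail (y + D) <= tail y ^+ 2.
Proof.
have half01 : 0 < (2^-1 : R) < 1 by apply/andP; split; lra.
have sqr_half (a : R) : 0 <= a -> (a `^ 2^-1) ^+ 2 = a.
  by move=> a0; rewrite -powR_mulrn ?powR_ge0// -powRrM mulVf ?powRr1.
have halfE : 1 - 2^-1 = 2^-1 :> R by lra.
have gm : gmean 2^-1 (tail (y - D)) (tail (y + D)) <= tail y.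
  apply: (prekopa_leindler _ _ _ 1 r) => //; try exact: vlog_concave_indic;
    try (by apply: vbounded_indic => x i; exact: tail_coord).
  move=> x x'; have [Tx|Tx] := pselect ((K `&` [set x | Y x < y - D]) x); last first.
    by rewrite (indic_notin _ _ _ _ Tx) gmean0l// indic_ge0.
  have [Tx'|Tx'] := pselect ((K `&` [set x | Y x < y + D]) x'); last first.
    by rewrite (indic_notin _ _ _ _ Tx') gmean0r// indic_ge0.
  rewrite (indic_in _ _ _ _ Tx) (indic_in _ _ _ _ Tx') gmeanxx// indic_in//.
  move: Tx Tx' => [Kx /= Yx] [Kx' /= Yx']; split; first exact: cK.
  by rewrite /= Y_affine; lra.
have : gmean 2^-1 (tail (y - D)) (tail (y + D)) ^+ 2 <= tail y ^+ 2.
  by rewrite ler_pXn2r ?nnegrE ?gmean_ge0.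
by rewrite /gmean halfE exprMn !sqr_half.
Qed.

Lemma geometric_sum_le (n : nat) : \sum_(k < n) (4^-1 : R) ^+ k <= 4 / 3.
Proof.
suff -> : \sum_(k < n) (4^-1 : R) ^+ k = 4 / 3 * (1 - 4^-1 ^+ n).
  by rewrite ler_piMr// ?gerBl ?exprn_ge0.
elim: n => [|n IH]; first by rewrite big_ord0 expr0 subrr mulr0.
by rewrite big_ord_recr/= IH exprS; field.
Qed.

(* With [m := N / V], Markov's inequality gives [tail (2 m) >= V / 2]; hence the ratio
   [tail (- dl) / tail (2 m)] is at most [1/4], and by log-concavity the tail keeps decaying by
   this factor on each further step of length [D := 2 m + dl] to the left, so that the sum of
   these tails bounds the integral of [neg]. *)
Lemma centroid_neg_part_le (dl : R) : 0 < dl -> tail (- dl) <= V / 8 -> N <= 7 / 4 * dl * V.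
Proof.
move=> dl0 tl; have N0 : 0 <= N.
  by apply: integral_Rd_ge0 => x; rewrite mulr_ge0 ?indic_ge0// le_max lexx orbT.
pose m := N / V; have NE : N = m * V by rewrite /m divfK// gt_eqF.
have m0 : 0 <= m by rewrite divr_ge0// ltW.
pose D := 2 * m + dl; have D0 : 0 < D by rewrite /D; lra.
have [mz|nzm] := eqVneq m 0; first by rewrite NE mz mul0r !mulr_ge0// ltW.
have mp : 0 < m by rewrite lt_neqAle eq_sym nzm.
have half : V / 2 <= tail (2 * m).
  have : integral_Rd (fun x => 2 * m * indic K x) <=
      integral_Rd (fun x => 2 * m * indic (K `&` [set x | Y x < 2 * m]) x + pos x).
    apply: le_integral_Rd => [||x]; first exact: vintegrableZ.
      by apply: vintegrableD => //; exact: vintegrableZ.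
    have [Kx|Kx] := pselect (K x); last first.
      by rewrite /pos !(indic_notin _ _ _ _ Kx) mul0r mulr0 addr0 mulr_ge0 ?indic_ge0//; lra.
    have [Ym|Ym] := ltP (Y x) (2 * m).
      rewrite !indic_in// lerDl mulr_ge0 ?indic_ge0// le_max lexx orbT//.
    rewrite indic_in// indic_notin; last by move=> [_ /=]; rewrite ltNge Ym.
    by rewrite mulr1 mulr0 add0r /pos indic_in// mul1r le_max Ym.
  rewrite integral_RdD//; last exact: vintegrableZ.
  rewrite !integral_RdZ// -/(vol _) -/(vol _) -/V -/(tail _) -/N NE => h.
  have : 2 * m * (V / 2) <= 2 * m * tail (2 * m) by move: h; lra.
  by rewrite ler_pM2l// mulr_gt0.
have ratio k : tail (- dl - k%:R * D) <= 4^-1 * tail (- dl - k%:R * D + D).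
  elim: k => [|k IH].
    have -> : - dl - 0 * D + D = 2 * m by rewrite /D; ring.
    by rewrite mul0r subr0; lra.
  have -> : - dl - k.+1%:R * D = - dl - k%:R * D - D by rewrite -natr1; ring.
  rewrite subrK; set y := _ - _ * D in IH *.
  have := tail_log_concave y D => LC.
  have [z|nz] := eqVneq (tail (y + D)) 0.
    have t0 : tail y = 0 by apply/le_anti; rewrite tail_ge0 andbT; move: IH; rewrite z mulr0.
    by rewrite t0 mulr0 -t0 tail_mono// gerBl ltW.
  have p : 0 < tail (y + D) by rewrite lt_neqAle eq_sym nz tail_ge0.
  rewrite -(ler_pM2r p); apply: le_trans LC _; rewrite expr2 [leRHS]mulrAC.
  by rewrite ler_wpM2r.
have geo k : tail (- dl - k%:R * D) <= 4^-1 ^+ k * (V / 8).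
  elim: k => [|k IH]; first by rewrite mul0r subr0 expr0 mul1r.
  apply: le_trans (ratio _) _; rewrite exprS -mulrA ler_pM2l//.
  by have -> : - dl - k.+1%:R * D + D = - dl - k%:R * D by rewrite -natr1; ring.
pose n := (Num.trunc (bound / D)).+1.
have nD : bound <= D * n%:R.
  by rewrite mulrC -ler_pdivrMr//; apply/ltW; exact: truncnS_gt.
pose T x : R := \sum_(k < n) indic (K `&` [set x | Y x < - dl - k%:R * D]) x.
have [iS eS] := vintegrable_sum _ _ _ _ (fun k : 'I_n => iT (- dl - k%:R * D)).
have : integral_Rd neg <= integral_Rd (fun x => dl * indic K x + D * T x).
  apply: le_integral_Rd => // [|x].
    by apply: vintegrableD; apply: vintegrableZ.
  have T0 : 0 <= T x by apply: sumr_ge0 => k _; exact: indic_ge0.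
  have [Kx|Kx] := pselect (K x); last first.
    by rewrite /neg (indic_notin _ _ _ _ Kx) mul0r mulr0 add0r mulr_ge0// ltW.
  rewrite /neg indic_in// mul1r mulr1 ge_max; apply/andP; split; last first.
    by rewrite addr_ge0// ?mulr_ge0// ltW.
  (* The shift by [D] cancels the error of the staircase and matches its level k + 1 with the tail
     of index k. *)
  have Yb : - Y x - dl + D <= D * n.+1%:R.
    have := Y_bound x Kx; rewrite ler_norml => /andP[h _].
    by rewrite -natr1 mulrDr mulr1; lra.
  have := le_staircase _ _ _ _ D0 Yb.
  suff -> : \sum_(k < n) (D * k.+1%:R < - Y x - dl + D)%R%:R = T x by lra.
  apply: eq_bigr => k _; case: ltP => h.
    by rewrite indic_in//; split => //=; move: h; rewrite -natr1; lra.
  by rewrite indic_notin// => -[_ /=]; move: h; rewrite -natr1; lra.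
rewrite N_neg integral_RdD; [|exact: vintegrableZ..].
rewrite !integral_RdZ// eS -/(vol K) -/V => h.
have S : \sum_(k < n) tail (- dl - k%:R * D) <= 4 / 3 * (V / 8).
  apply: (@le_trans _ _ (\sum_(k < n) 4^-1 ^+ k * (V / 8))); first exact: ler_sum.
  rewrite -mulr_suml ler_wpM2r ?geometric_sum_le//.
  by rewrite divr_ge0// ltW.
have {S}h2 : N <= dl * V + D * (4 / 3 * (V / 8)).
  by apply: le_trans h _; rewrite lerD2l ler_pM2l.
(* As D = 2m + dl, this reads m <= 7/6 dl + m/3; absorbing m/3 gives the constant 7/4. *)
have : m * V <= (dl + D / 6) * V by rewrite -NE; apply: le_trans h2 _; lra.
by rewrite ler_pM2r// => h3; rewrite NE ler_pM2r//; move: h3; rewrite /D; lra.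
Qed.

Lemma vintegrable_cut (c : R) :
  vintegrable (indic (K `&` [set x | c <= dotp (x - cg K) v])).
Proof.
apply: (vintegrable_indic _ _ _ r) => // [|x i [Kx _]]; last exact: Kr.
move=> t x y t01 [Kx xy] [Ky yy]; split; first exact: cK.
have /andP[t0 t1] := t01; have t1' : 0 < 1 - t by rewrite subr_gt0.
have := Y_affine t x y; rewrite /Y /= => ->; move: xy yy => /=.
by rewrite -(ler_pM2l t0) -[_ <= dotp (y - _) _](ler_pM2l t1'); lra.
Qed.

(** The cases are split by whether the tail below [- dl] exceeds V/8: if it does, its complement is
    the small piece; otherwise the two bounds on N combine, with 7/2 = 2 * 7/4. *)
Lemma centroid_cut (dl : R) : (0 < d)%N -> 0 < dl ->
  dotp (w - cg K) v <= 7 / 2 * expR 1 * d%:R * dl \/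
  vol (K `&` [set x | - dl <= dotp (x - cg K) v]) <= 7 / 8 * vol K.
Proof.
move=> d0 dl0; have [tl|tl] := leP (tail (- dl)) (V / 8).
  left; have h := centroid_neg_part_le _ dl0 tl; have h' := centroid_pos_part_ge d0.
  rewrite -(ler_pM2r V0) -/V -/(Y w); apply: le_trans h' _.
  have -> : 7 / 2 * expR 1 * d%:R * dl * V = 2 * expR 1 * d%:R * (7 / 4 * dl * V) by field.
  by rewrite ler_wpM2l// !mulr_ge0// expR_ge0.
right; set A := K `&` _.
have : vol A + tail (- dl) <= V.
  have iA : vintegrable (indic A) by exact: vintegrable_cut.
  rewrite /vol /tail /vol -integral_RdD//; apply: le_integral_Rd => // [|x].
    exact: vintegrableD.
  have [Kx|Kx] := pselect (K x); last by rewrite !indic_notin ?addr0// => -[].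
  have [h|h] := leP (- dl) (Y x).
    rewrite (indic_notin _ _ (K `&` [set x | Y x < - dl])) ?addr0; last first.
      by move=> [_ /=]; rewrite ltNge h.
    by apply: indic_le => z [].
  rewrite (indic_notin _ _ A) ?add0r; first by apply: indic_le => z [].
  by move=> [_ /=]; rewrite leNgt h.
by move: tl; rewrite -/V; lra.
Qed.

End CentroidCut.

(** * The regret bound *)

Section Regret.
Variables (R : realType) (d T : nat) (wstar : 'rV[R]_d) (O : oracle_t R d).
Hypotheses (T0 : (1 <= T)%N) (wB : norm2 wstar <= 1) (OK : valid_oracle T wstar O).

Let h t := history T O t.
Let eps : R := T%:R^-1.
Let body t : set 'rV[R]_d := minkowski (knowledge (h t)) (ballB eps).

Let TR0 : (0 : R) < T%:R.
Proof. by rewrite ltr0n. Qed.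

Let eps0 : 0 < eps.
Proof. by rewrite invr_gt0. Qed.

Let eps1 : eps <= 1.
Proof. by rewrite invf_le1// ler1n. Qed.

Let eps2 : 1 + eps <= 2.
Proof. by have := eps1; lra. Qed.

Let eps_le2 : eps <= 2.
Proof. by have := eps1; lra. Qed.

Let history_mono t t' pv : (t <= t')%N -> pv \in h t -> pv \in h t'.
Proof.
move=> /subnK <-; elim: (t' - t)%N => [//|n IH] /IH H.
by rewrite addSn /h /= mem_rcons inE -/(h _) H orbT.
Qed.

(** Since T >= 1 the oracle has returned a unit vector, and dimension 0 has none. *)
Let dim_gt0 : (0 < d)%N.
Proof.
rewrite lt0n; apply/eqP => d0.
have : (query T (h 0), O (h 0) (query T (h 0))) \in h 1 by rewrite /h /= inE.
move=> /(history_mono _ _ _ T0) /OK[/= n1 _].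
move: n1; rewrite /norm2 big1 ?sqrtr0; first by move/eqP; rewrite eq_sym oner_eq0.
by move=> [i id] _; exfalso; move: id; rewrite d0.
Qed.

Let knowledge_convex t : convex (knowledge (h t)).
Proof.
move=> s x y s01 [xB xh] [yB yh]; split; first exact: convex_ball.
move=> pv pvh; move: (xh _ pvh) (yh _ pvh); rewrite /halfspace /=.
have /andP[s0 s1] := s01; rewrite !dotpBl dotpDl !dotpZl => hx hy.
have := mulr_ge0 (ltW s0) hx.
have s1' : 0 <= 1 - s by rewrite subr_ge0 ltW.
have := mulr_ge0 s1' hy; lra.
Qed.

Let wstar_knowledge t : (t <= T)%N -> knowledge (h t) wstar.
Proof.
move=> tT; split => // pv /(history_mono _ _ _ tT) /OK[_ ge].
by rewrite /halfspace /= dotpBl subr_ge0.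
Qed.

Let ball0 : @ballB R d eps 0.
Proof.
by rewrite /ballB /= -(scale0r (0 : 'rV[R]_d)) norm2Z normr0 mul0r ltW.
Qed.

Let wstar_body t : (t <= T)%N -> body t wstar.
Proof.
by move=> tT; exists wstar, 0; rewrite addr0; split; [exact: wstar_knowledge|].
Qed.

Let body_convex t : convex (body t).
Proof. by apply: convex_minkowski; [exact: knowledge_convex|exact: convex_ball]. Qed.

Let body_sub_ball t : body t `<=` ballB (1 + eps).
Proof.
move=> _ [x [y [[xB _] [yB ->]]]]; apply: le_trans (norm2D _ _ _ _) _; exact: lerD.
Qed.

Let ball_coord (a : R) : a <= 2 -> forall x i, @ballB R d a x -> `|x 0 i| <= 2.
Proof.
move=> a2 x i xa; apply: le_trans (coord_le_norm2 _ _ _ _) _; exact: le_trans a2.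
Qed.

Let body_coord t x i : body t x -> `|x 0 i| <= 2.
Proof. by move/body_sub_ball; exact: ball_coord. Qed.

Let integrable_ball (a : R) : a <= 2 -> vintegrable (indic (@ballB R d a)).
Proof.
by move=> a2; apply: (vintegrable_indic _ _ _ 2) => //; [exact: convex_ball|exact: ball_coord].
Qed.

Let integrable_body t : vintegrable (indic (body t)).
Proof. by apply: (vintegrable_indic _ _ _ 2) => // x i; exact: body_coord. Qed.

(* Potential of round [t]: [ln (vol (body t))], which decreases from at most
   [d ln (T + 1) + ln v0] to at least [ln v0]. *)
Let v0 : R := vol (@ballB R d eps).

(** The ball contains the cube of half-side eps/d, because d (eps/d)^2 <= eps^2. *)
Let v0_gt0 : 0 < v0.
Proof.
pose rho : R := eps / d%:R.
have dR : (1 : R) <= d%:R by rewrite ler1n.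
have dp : (0 : R) < d%:R by rewrite ltr0n.
have rho0 : 0 < rho by rewrite divr_gt0.
apply: (@lt_le_trans _ _ ((2 * rho) ^+ d)); first by rewrite exprn_gt0// mulr_gt0.
apply: cube_le_integral_Rd => [||x|x xrho]; first exact: ltW.
- exact: integrable_ball.
- exact: indic_ge0.
rewrite indic_in// /ballB /= -(@ler_pXn2r _ 2)// ?nnegrE ?norm2_ge0 ?(ltW eps0)//.
rewrite sqr_norm2; apply: (@le_trans _ _ (\sum_(i < d) rho ^+ 2)).
  apply: ler_sum => i _; rewrite -[leLHS]real_normK ?num_real//.
  by rewrite ler_pXn2r ?nnegrE ?(ltW rho0).
rewrite sumr_const card_ord -mulr_natl /rho expr_div_n mulrC.
rewrite -mulrA ler_piMr ?sqr_ge0// expr2 invfM -mulrA mulVf ?gt_eqF// mulr1.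
by rewrite invf_le1.
Qed.

Let v0_le_body t : (t <= T)%N -> v0 <= vol (body t).
Proof.
move=> tT; have [iB eB] := integral_Rd_affine _ _ 1 wstar _ ltr01 (integrable_body t)
  (indic_ge0 _ _ _).
rewrite /vol eB expr1n mul1r; apply: le_integral_Rd => //.
  exact: integrable_ball.
move=> x; have [xB|xB] := pselect (ballB eps x); last by rewrite indic_notin// indic_ge0.
rewrite !indic_in//; exists wstar, x; split; first exact: wstar_knowledge.
by rewrite scale1r addrC.
Qed.

Let vol_body_gt0 t : (t <= T)%N -> 0 < vol (body t).
Proof. by move=> tT; apply: lt_le_trans (v0_le_body _ tT). Qed.

(** The balls of radius 1 + 1/T and 1/T are homothetic with ratio T + 1. *)
Let body0_le : vol (body 0) <= (T%:R + 1) ^+ d * v0.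
Proof.
have T1 : (0 : R) < T%:R + 1 by rewrite addr_gt0.
have iB : vintegrable (indic (@ballB R d (1 + eps))) by exact: integrable_ball.
apply: (@le_trans _ _ (vol (@ballB R d (1 + eps)))).
  by apply: le_integral_Rd => // x; apply: indic_le; exact: body_sub_ball.
have [_ eB] := integral_Rd_affine _ _ (T%:R + 1) 0 _ T1 iB (indic_ge0 _ _ _).
rewrite /v0 /vol eB le_eqVlt; apply/orP; left; apply/eqP; congr (_ * integral_Rd _).
apply/funext => x; rewrite addr0 /indic; congr (if _ then _ else _); congr asbool.
apply/propext; rewrite /ballB /= norm2Z gtr0_norm//.
have -> : 1 + eps = (T%:R + 1) * eps by rewrite /eps; field; rewrite gt_eqF.
by rewrite ler_pM2l.
Qed.

Let q t := query T (h t).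
Let dir t := O (h t) (q t).

Let in_history t : (t < T)%N -> (q t, dir t) \in h T.
Proof. by move=> tT; apply: (history_mono _ _ _ tT); rewrite /h /= mem_rcons inE eqxx. Qed.

(** The direction is a unit vector, so adding a point of the small ball lowers the linear form by at
    most [eps]. *)
Let body_next t : (t < T)%N ->
  body t.+1 `<=` body t `&` [set x | - eps <= dotp (x - q t) (dir t)].
Proof.
move=> tT _ [x [y [[xB xh] [yB ->]]]].
have [/= n1 _] := OK _ (in_history _ tT).
split.
  exists x, y; split => //; split => // pv pvh; apply: xh.
  by rewrite /h /= mem_rcons inE -/(h t) pvh orbT.
have /xh : (q t, dir t) \in h t.+1 by rewrite /h /= mem_rcons inE eqxx.
rewrite /halfspace /= !(dotpDl, dotpNl) => hx.
have := le_trans (dotp_le_norm2 _ _ y (dir t)) (ler_wpM2r (norm2_ge0 _ _ _) yB).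
rewrite n1 mulr1 ler_norml => /andP[hy _]; lra.
Qed.

(** The form is at most 1 at [wstar] and at least -2 on the body; [centroid_lower_bound] transfers
    the latter to the centroid without locating it in the body. *)
Let round_le3 t : (t < T)%N -> dotp (wstar - q t) (dir t) <= 3.
Proof.
move=> tT; have [/= n1 _] := OK _ (in_history _ tT).
rewrite -subr_le0; have := centroid_lower_bound R d (body t) 2 (dir t) _ (body_convex t)
  (body_coord t) (vol_body_gt0 _ (ltnW tT)); apply => // x xb.
have := body_sub_ball _ _ xb; rewrite /ballB /= => xn.
have := dotp_le_norm2 _ _ x (dir t); have := dotp_le_norm2 _ _ wstar (dir t).
rewrite n1 !mulr1 !ler_norml -/(body t) => /andP[_ w1] /andP[x1 _].
rewrite (_ : cg (body t) = q t)//.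
by have := eps1; have := wB; rewrite !dotpBl; lra.
Qed.

Let c0 : R := 7 / 2 * expR 1.
(** Largest regret of a round divided by the decrease of the potential that a genuine cut
    guarantees. *)
Let c1 : R := 3 / ln (8 / 7).

Let ln87 : 0 < ln (8 / 7 : R).
Proof. by rewrite ln_gt0//; lra. Qed.

(** Both terms on the right are nonnegative, so the dichotomy becomes one inequality, whose second
    term telescopes over the rounds. *)
Let round_le t : (t < T)%N -> dotp (wstar - q t) (dir t) <=
  c0 * d%:R * eps + c1 * (ln (vol (body t)) - ln (vol (body t.+1))).
Proof.
move=> tT; have Vt := vol_body_gt0 _ (ltnW tT); have Vt1 := vol_body_gt0 _ tT.
have c1_ge0 : 0 <= c1 by rewrite divr_ge0// ltW.
have mono : vol (body t.+1) <= vol (body t).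
  by apply: le_integral_Rd => // x; apply: indic_le => z /(body_next _ tT)[].
have [small|cut] := centroid_cut R d (body t) 2 (dir t) wstar (ler0n R 2) (body_convex t)
  (body_coord t) Vt (wstar_body _ (ltnW tT)) _ dim_gt0 eps0.
  apply: le_trans small _; rewrite lerDl mulr_ge0// subr_ge0 ler_ln ?posrE//.
apply: le_trans (round_le3 _ tT) _.
have V87 : 8 / 7 * vol (body t.+1) <= vol (body t).
  have : vol (body t.+1) <= 7 / 8 * vol (body t).
    apply: le_trans cut; apply: le_integral_Rd => //.
      exact: (vintegrable_cut R d (body t) 2 (dir t) (ler0n R 2) (body_convex t) (body_coord t)).
    by move=> x; apply: indic_le; exact: body_next.
  lra.
have : ln (8 / 7 * vol (body t.+1)) <= ln (vol (body t)).
  by rewrite ler_ln ?posrE// mulr_gt0//; lra.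
rewrite lnM ?posrE//.
rewrite -lerBrDr => h1; have := ler_wpM2l c1_ge0 h1.
rewrite {1}/c1 divfK ?gt_eqF// => h2; apply: le_trans h2 _.
by rewrite lerDr !mulr_ge0 ?expR_ge0// ltW.
Qed.

Let partial_regret t : (t <= T)%N -> \sum_(pv <- h t) dotp (wstar - pv.1) pv.2 <=
  t%:R * (c0 * d%:R * eps) + c1 * (ln (vol (body 0)) - ln (vol (body t))).
Proof.
elim: t => [_|t IH tT]; first by rewrite /h /= big_nil mul0r subrr mulr0 addr0.
have := IH (ltnW tT); have := round_le _ tT.
rewrite [h t.+1]/(rcons (h t) (q t, dir t)) big_rcons/= -natr1; lra.
Qed.

Lemma regret_le : regret T wstar O <= (c0 + c1) * d%:R * (1 + ln (T%:R : R)).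
Proof.
apply: le_trans (partial_regret _ (leqnn T)) _.
have c1_ge0 : 0 <= c1 by rewrite divr_ge0// ltW.
have c0_ge0 : 0 <= c0 by rewrite mulr_ge0// ?expR_ge0//; lra.
have T1 : (0 : R) < T%:R + 1 by rewrite addr_gt0.
have lnT : 0 <= ln (T%:R : R) by rewrite ln_ge0// ler1n.
have hd : ln (vol (body 0)) - ln (vol (body T)) <= d%:R * (1 + ln (T%:R : R)).
  have h1 : ln (vol (body 0)) <= ln ((T%:R + 1) ^+ d * v0).
    by rewrite ler_ln ?posrE ?mulr_gt0 ?exprn_gt0// vol_body_gt0.
  have h2 : ln v0 <= ln (vol (body T)).
    by rewrite ler_ln ?posrE ?vol_body_gt0// v0_le_body.
  (* From T + 1 <= 2T <= eT. *)
  have h3 : ln (T%:R + 1 : R) <= 1 + ln T%:R.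
    have -> : 1 + ln T%:R = ln (expR 1 * T%:R) :> R by rewrite lnM ?posrE ?expR_gt0// expRK.
    rewrite ler_ln ?posrE ?mulr_gt0 ?expR_gt0//.
    have : 2 * T%:R <= expR 1 * T%:R :> R.
      by rewrite ler_pM2r//; have := expR_ge1Dx (1 : R); lra.
    have : (1 : R) <= T%:R by rewrite ler1n.
    lra.
  move: h1; rewrite lnM ?posrE ?exprn_gt0// lnXn// -[ln _ *+ d]mulr_natl => h1.
  have h4 : d%:R * ln (T%:R + 1 : R) <= d%:R * (1 + ln T%:R) by rewrite ler_wpM2l.
  lra.
have e1 : T%:R * (c0 * d%:R * eps) = c0 * d%:R by rewrite /eps; field; rewrite gt_eqF.
have e2 := ler_wpM2l c1_ge0 hd.
have e3 : 0 <= c0 * d%:R * ln (T%:R : R) by rewrite !mulr_ge0.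
rewrite e1; lra.
Qed.

End Regret.

(** [C] is chosen before [d] and [T]. The factor is [1 + ln T] because [ln T] vanishes at T = 1,
    where the regret may be positive. *)
Theorem theorem4p4 (R : realType) :
  exists C : R, forall (d T : nat), (1 <= T)%N ->
    forall (wstar : 'rV[R]_d), norm2 wstar <= 1 ->
    forall (O : oracle_t R d), valid_oracle T wstar O ->
      regret T wstar O <= C * d%:R * (1 + ln (T%:R : R)).
Proof.
exists (7 / 2 * expR 1 + 3 / ln (8 / 7)) => d T T0 wstar wB O OK.
exact: regret_le.
Qed.
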